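(* Let $k$ be a field, let $Q=(Q_0,Q_1,s,t)$ be a finite graph which is $(Q',v_0)$-trimmable for a sub-graph $Q'$ of $Q$ and a vertex $v_0\in Q_0$ whose only outgoing edge is the loop $x_0$, and let $Q''$ be the sub-graph of $Q$ obtained by removing the edge $x_0$ (keeping all vertices and all other edges). Let $\pi_1\colon L_k(Q)\to L_k(Q')$, $\pi_2\colon L_k(Q'')\to L_k(Q')$, $f\colon L_k(Q)\to L_k(Q'')\otimes k[u,u^{-1}]$ and $\delta\colon L_k(Q')\to L_k(Q')\otimes k[u,u^{-1}]$ be the $\mathbb{Z}$-graded algebra homomorphisms given on generators by the formulas in the context. Then the commutative square of $\mathbb{Z}$-graded algebra homomorphisms $$\delta\circ\pi_1=(\pi_2\otimes\mathrm{id})\circ f\colon\; L_k(Q)\to L_k(Q')\otimes k[u,u^{-1}]$$ is a pullback diagram; that is, the map $$L_k(Q)\longrightarrow\left\{(a,b)\in L_k(Q')\times\left(L_k(Q'')\otimes k[u,u^{-1}]\right)\;\middle|\;\delta(a)=(\pi_2\otimes\mathrm{id})(b)\right\},\qquad p\longmapsto(\pi_1(p),f(p)),$$ is an isomorphism of $\mathbb{Z}$-graded algebras.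
   Context: **Graphs.** A graph $Q=(Q_0,Q_1,s,t)$ consists of a set of vertices $Q_0$, a set of edges $Q_1$, and source and target maps $s,t\colon Q_1\to Q_0$. It is finite if $Q_0$ and $Q_1$ are both finite. A sub-graph $Q'=(Q'_0,Q'_1,s',t')$ of $Q$ is a graph with $Q'_0\subseteq Q_0$, $Q'_1\subseteq Q_1$, and $s',t'$ the restrictions-corestrictions of $s,t$. **Leavitt path algebras.** For a graph $Q$, let $Q_1^*=\{x^*\mid x\in Q_1\}$ be the set of ghost edges. The Leavitt path algebra $L_k(Q)$ is the universal (associative) $k$-algebra generated by the elements $v\in Q_0$, $x\in Q_1$, $x^*\in Q_1^*$ subject to the relations: (L1) $v_iv_j=\delta_{ij}v_i$ for all $v_i,v_j\in Q_0$; (L2) $s(x)x=x\,t(x)=x$ for all $x\in Q_1$; (L3) $t(x)x^*=x^*s(x)=x^*$ for all $x^*\in Q_1^*$; (L4) $x_i^*x_j=\delta_{ij}t(x_i)$ for all $x_i,x_j\in Q_1$; (L5) $\sum_{x\in s^{-1}(v)}xx^*=v$ for all $v\in Q_0$ such that $s^{-1}(v)$ is finite and nonempty. The standard $\mathbb{Z}$-grading on $L_k(Q)$ is the one in which vertices have degree $0$, edges have degree $1$ and ghost edges have degree $-1$. **Trimmable graphs.** A finite graph $Q$ is called $(Q',v_0)$-trimmable, where $Q'$ is a sub-graph of $Q$, if $$Q_0=Q'_0\cup\{v_0\},\quad v_0\notin Q'_0,\quad Q_1=Q'_1\cup t^{-1}(v_0),$$ $$s^{-1}(v_0)=\{x_0\},\quad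 t(x_0)=v_0,\quad t^{-1}(v_0)\setminus\{x_0\}\neq\emptyset,$$ $$\forall\, v\in s\big(t^{-1}(v_0)\setminus\{x_0\}\big):\quad s^{-1}(v)\setminus t^{-1}(v_0)\neq\emptyset.$$ That is, $Q'$ emits at least one edge to the external vertex $v_0$, the only outgoing edge $x_0$ of $v_0$ is a loop, and every edge from $Q'$ to $v_0$ begins in a vertex that also emits an edge ending inside $Q'$. **The homomorphisms.** Here $\otimes$ is the tensor product over $k$ and $k[u,u^{-1}]$ is the Laurent polynomial algebra. The following formulas on generators define algebra homomorphisms: (1) $\pi_1\colon L_k(Q)\to L_k(Q')$: $\pi_1(\alpha)=\alpha$ if $\alpha\in Q'_0\cup Q'_1\cup (Q'_1)^*$, and $\pi_1(\alpha)=0$ for all other generators. (2) $\pi_2\colon L_k(Q'')\to L_k(Q')$: $\pi_2(\alpha)=\alpha$ if $\alpha\in Q'_0\cup Q'_1\cup (Q'_1)^*$, and $\pi_2(\alpha)=0$ for all other generators. (3) $f\colon L_k(Q)\to L_k(Q'')\otimes k[u,u^{-1}]$: $f(\alpha)=\alpha\otimes 1$ if $\alpha\in Q_0$; $f(x_0)=v_0\otimes u$; $f(x_0^* )=v_0\otimes u^{-1}$; $f(\alpha)=\alpha\otimes u$ if $\alpha\in Q_1\setminus\{x_0\}$; $f(\alpha)=\alpha\otimes u^{-1}$ if $\alpha\in Q_1^*\setminus\{x_0^*\}$. (4) $\delta\colon L_k(Q')\to L_k(Q')\otimes k[u,u^{-1}]$: $\delta(\alpha)=\alpha\otimes 1$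 if $\alpha\in Q'_0$; $\delta(\alpha)=\alpha\otimes u$ if $\alpha\in Q'_1$; $\delta(\alpha)=\alpha\otimes u^{-1}$ if $\alpha\in (Q'_1)^*$. **Gradings.** $L_k(Q)$, $L_k(Q')$, $L_k(Q'')$ carry their standard $\mathbb{Z}$-gradings. The tensor products $L_k(Q')\otimes k[u,u^{-1}]$ and $L_k(Q'')\otimes k[u,u^{-1}]$ are graded by the rightmost tensor factor only: the degree-$n$ component is $L_k(Q')\otimes ku^n$, respectively $L_k(Q'')\otimes ku^n$. The pullback algebra carries the componentwise operations and the componentwise grading (its degree-$n$ part consists of the pairs $(a,b)$ with both $a$ and $b$ homogeneous of degree $n$). *)

(* Defs.v *)
From HB Require Import structures.
From mathcomp Require Import all_boot all_order all_algebra.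
From mathcomp Require Import boolp.

Set Implicit Arguments.
Unset Strict Implicit.
Unset Printing Implicit Defensive.

Import GRing.Theory.
Local Open Scope ring_scope.
Local Open Scope quotient_scope.

(* Associative, not necessarily unital, algebras over a field. MathComp's
   [algType] is unital with [1 != 0], whereas Leavitt path algebras are
   universal among all associative algebras and may vanish (empty graph). *)

HB.mixin Record Lmodule_isAssocAlgebra (k : fieldType) A
    of GRing.Lmodule k A := {
  amul : A -> A -> A;
  amulA : associative amul;
  amulDl : left_distributive amul +%R;
  amulDr : right_distributive amul +%R;
  ascalerAl : forall (c : k) (x y : A), c *: amul x y = amul (c *: x) y;
  ascalerAr : forall (c : k) (x y : A), c *: amul x y = amul x (c *: y)
}.

#[short(type="assocAlgType")]
HB.structure Definition AssocAlgebra (k : fieldType) :=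
  {A of GRing.Lmodule k A & Lmodule_isAssocAlgebra k A}.

Notation "x ** y" := (amul x y) (at level 40, left associativity) : ring_scope.

HB.mixin Record isAmulMorphism (k : fieldType) (A B : assocAlgType k)
    (f : A -> B) := {
  amorphM : {morph f : x y / x ** y}
}.

HB.structure Definition AlgHom (k : fieldType) (A B : assocAlgType k) :=
  {f of @GRing.Linear k A B *:%R f & isAmulMorphism k A B f}.

Notation "{ 'alghom' A -> B }" := (AlgHom.type A%type B%type)
  (at level 0, A at level 98, B at level 99,
   format "{ 'alghom'  A  ->  B }") : type_scope.

Section AssocAlgebraTheory.
Variables (k : fieldType) (A : assocAlgType k).

Lemma amul0l (x : A) : 0 ** x = 0.
Proof. by have := ascalerAl 0 0 x; rewrite !scale0r. Qed.

Lemma amul0r (x : A) : x ** 0 = 0.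
Proof. by have := ascalerAr 0 x 0; rewrite !scale0r. Qed.

End AssocAlgebraTheory.

HB.instance Definition _ (k : fieldType) (A : assocAlgType k) :=
  isAmulMorphism.Build k A A idfun (fun _ _ => erefl).

Section PairAlgebra.
Variables (k : fieldType) (A B : assocAlgType k).
Implicit Types x y z : A * B.

Definition pair_amul x y : A * B := (x.1 ** y.1, x.2 ** y.2).

Lemma pair_amulA : associative pair_amul.
Proof. by move=> x y z; congr pair; rewrite amulA. Qed.
Lemma pair_amulDl : left_distributive pair_amul +%R.
Proof. by move=> x y z; congr pair; rewrite amulDl. Qed.
Lemma pair_amulDr : right_distributive pair_amul +%R.
Proof. by move=> x y z; congr pair; rewrite amulDr. Qed.
Lemma pair_ascalerAl (c : k) x y :
  c *: pair_amul x y = pair_amul (c *: x) y.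
Proof. by congr pair; rewrite ascalerAl. Qed.
Lemma pair_ascalerAr (c : k) x y :
  c *: pair_amul x y = pair_amul x (c *: y).
Proof. by congr pair; rewrite ascalerAr. Qed.

HB.instance Definition _ := Lmodule_isAssocAlgebra.Build k (A * B)%type
  pair_amulA pair_amulDl pair_amulDr pair_ascalerAl pair_ascalerAr.

End PairAlgebra.

Section Pullback.
Variables (k : fieldType) (A B C : assocAlgType k).
Variables (g : {alghom A -> C}) (h : {alghom B -> C}).

Definition pullback_pred : {pred A * B} := fun x => g x.1 == h x.2.

Record pullback := Pullback {
  pullback_val :> A * B; _ : pullback_val \in pullback_pred }.

HB.instance Definition _ := [isSub for pullback_val].
HB.instance Definition _ := [Choice of pullback by <:].

Lemma in_pullback x : (x \in pullback_pred) = (g x.1 == h x.2).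
Proof. by []. Qed.

Lemma pullback_submod : subsemimod_closed pullback_pred.
Proof.
split; first split.
- by rewrite in_pullback !linear0.
- by move=> x y; rewrite !in_pullback !linearD /= => /eqP-> /eqP->.
- by move=> c x; rewrite !in_pullback !linearZ /= => /eqP->.
Qed.

HB.instance Definition _ :=
  GRing.SubChoice_isSubLmodule.Build k (A * B)%type pullback_pred pullback
    pullback_submod.

Fact pullback_amul_subproof (x y : pullback) :
  val x ** val y \in pullback_pred.
Proof.
move: (valP x) (valP y); rewrite !in_pullback => /eqP xP /eqP yP; apply/eqP.
by rewrite [LHS](amorphM (s := g)) [RHS](amorphM (s := h)) xP yP.
Qed.

Definition pullback_amul (x y : pullback) : pullback :=
  Pullback (pullback_amul_subproof x y).

Lemma pullback_amulA : associative pullback_amul.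
Proof. by move=> x y z; apply/val_inj; rewrite /= amulA. Qed.
Lemma pullback_amulDl : left_distributive pullback_amul +%R.
Proof. by move=> x y z; apply/val_inj; rewrite /= amulDl. Qed.
Lemma pullback_amulDr : right_distributive pullback_amul +%R.
Proof. by move=> x y z; apply/val_inj; rewrite /= amulDr. Qed.
Lemma pullback_ascalerAl (c : k) x y :
  c *: pullback_amul x y = pullback_amul (c *: x) y.
Proof. by apply/val_inj; rewrite /= ascalerAl. Qed.
Lemma pullback_ascalerAr (c : k) x y :
  c *: pullback_amul x y = pullback_amul x (c *: y).
Proof. by apply/val_inj; rewrite /= ascalerAr. Qed.

HB.instance Definition _ := Lmodule_isAssocAlgebra.Build k pullback
  pullback_amulA pullback_amulDl pullback_amulDr
  pullback_ascalerAl pullback_ascalerAr.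

End Pullback.

Section Tensor.
Variables (k : fieldType) (A B : lmodType k).

(* Formal expressions in the pure tensors, and the least congruence making
   them a k-module in which [a (x) b] is bilinear. *)
Inductive tterm :=
  | TPure of A & B
  | TZero
  | TOpp of tterm
  | TAdd of tterm & tterm
  | TScale of k & tterm.

Inductive tcong : tterm -> tterm -> Prop :=
  | tcong_refl s : tcong s s
  | tcong_sym s t : tcong s t -> tcong t s
  | tcong_trans s t r : tcong s t -> tcong t r -> tcong s r
  | tcong_opp s s' : tcong s s' -> tcong (TOpp s) (TOpp s')
  | tcong_add s s' t t' :
      tcong s s' -> tcong t t' -> tcong (TAdd s t) (TAdd s' t')
  | tcong_scale c s s' : tcong s s' -> tcong (TScale c s) (TScale c s')
  | tcong_addA s t r : tcong (TAdd s (TAdd t r)) (TAdd (TAdd s t) r)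
  | tcong_addC s t : tcong (TAdd s t) (TAdd t s)
  | tcong_add0 s : tcong (TAdd TZero s) s
  | tcong_addN s : tcong (TAdd (TOpp s) s) TZero
  | tcong_scaleA c d s :
      tcong (TScale c (TScale d s)) (TScale (c * d) s)
  | tcong_scale1 s : tcong (TScale 1 s) s
  | tcong_scaleDr c s t :
      tcong (TScale c (TAdd s t)) (TAdd (TScale c s) (TScale c t))
  | tcong_scaleDl s c d :
      tcong (TScale (c + d) s) (TAdd (TScale c s) (TScale d s))
  | tcong_pureDl a a' b :
      tcong (TPure (a + a') b) (TAdd (TPure a b) (TPure a' b))
  | tcong_pureDr a b b' :
      tcong (TPure a (b + b')) (TAdd (TPure a b) (TPure a b'))
  | tcong_pureZl c a b : tcong (TPure (c *: a) b) (TScale c (TPure a b))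
  | tcong_pureZr c a b : tcong (TPure a (c *: b)) (TScale c (TPure a b)).

HB.instance Definition _ := gen_eqMixin tterm.
HB.instance Definition _ := gen_choiceMixin tterm.

Definition tcongb : rel tterm := fun s t => `[< tcong s t >].

Lemma tcongb_refl : reflexive tcongb.
Proof. by move=> s; apply/asboolP/tcong_refl. Qed.
Lemma tcongb_sym : symmetric tcongb.
Proof. by move=> s t; apply/asbool_equiv_eq; split; apply: tcong_sym. Qed.
Lemma tcongb_trans : transitive tcongb.
Proof.
move=> t s r /asboolP st /asboolP tr; apply/asboolP.
exact: tcong_trans st tr.
Qed.

Canonical tcong_equiv := EquivRel tcongb tcongb_refl tcongb_sym tcongb_trans.

Definition tensor := {eq_quot tcong_equiv}.
HB.instance Definition _ : EqQuotient _ tcong_equiv tensor :=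
  EqQuotient.on tensor.
HB.instance Definition _ := Choice.on tensor.

Definition tclass (s : tterm) : tensor := \pi_tensor s.

Lemma tclassP s t : tclass s = tclass t <-> tcong s t.
Proof.
split=> [/eqmodP/asboolP //|st]; apply/eqmodP.
exact/asboolP.
Qed.

Lemma tclass_repr (x : tensor) : tclass (repr x) = x.
Proof. exact: reprK. Qed.

Lemma tcong_repr s : tcong (repr (tclass s)) s.
Proof. by apply/tclassP; rewrite tclass_repr. Qed.

Lemma tensor_repr_ind (P : tensor -> Prop) :
  (forall s, P (tclass s)) -> forall x, P x.
Proof. by move=> Ps x; rewrite -[x]tclass_repr. Qed.

Definition tens_opp (x : tensor) : tensor := tclass (TOpp (repr x)).
Definition tens_add (x y : tensor) : tensor := tclass (TAdd (repr x) (repr y)).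
Definition tens_scale (c : k) (x : tensor) : tensor :=
  tclass (TScale c (repr x)).

Lemma tclass_opp s : tclass (TOpp s) = tens_opp (tclass s).
Proof. by apply/tclassP/tcong_opp/tcong_sym/tcong_repr. Qed.
Lemma tclass_add s t :
  tclass (TAdd s t) = tens_add (tclass s) (tclass t).
Proof. by apply/tclassP/tcong_add; apply/tcong_sym/tcong_repr. Qed.
Lemma tclass_scale c s :
  tclass (TScale c s) = tens_scale c (tclass s).
Proof. by apply/tclassP/tcong_scale/tcong_sym/tcong_repr. Qed.

Definition tclassE := (tclass_opp, tclass_add, tclass_scale).

Lemma tens_addA : associative tens_add.
Proof.
elim/tensor_repr_ind=> s; elim/tensor_repr_ind=> t; elim/tensor_repr_ind=> r.
by rewrite -!tclassE; apply/tclassP/tcong_addA.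
Qed.
Lemma tens_addC : commutative tens_add.
Proof.
elim/tensor_repr_ind=> s; elim/tensor_repr_ind=> t.
by rewrite -!tclassE; apply/tclassP/tcong_addC.
Qed.
Lemma tens_add0 : left_id (tclass TZero) tens_add.
Proof.
by elim/tensor_repr_ind=> s; rewrite -!tclassE; apply/tclassP/tcong_add0.
Qed.
Lemma tens_addN : left_inverse (tclass TZero) tens_opp tens_add.
Proof.
by elim/tensor_repr_ind=> s; rewrite -!tclassE; apply/tclassP/tcong_addN.
Qed.

HB.instance Definition _ :=
  GRing.isZmodule.Build tensor tens_addA tens_addC tens_add0 tens_addN.

Lemma tens_scaleA c d (x : tensor) :
  tens_scale c (tens_scale d x) = tens_scale (c * d) x.
Proof.
by elim/tensor_repr_ind: x => s; rewrite -!tclassE; apply/tclassP/tcong_scaleA.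
Qed.
Lemma tens_scale1 : left_id 1 tens_scale.
Proof.
by elim/tensor_repr_ind=> s; rewrite -!tclassE; apply/tclassP/tcong_scale1.
Qed.
Lemma tens_scaleDr : right_distributive tens_scale +%R.
Proof.
move=> c; elim/tensor_repr_ind=> s; elim/tensor_repr_ind=> t.
rewrite /+%R /= -!tclassE; exact/tclassP/tcong_scaleDr.
Qed.
Lemma tens_scaleDl (x : tensor) :
  {morph tens_scale^~ x : c d / c + d >-> c + d}.
Proof.
elim/tensor_repr_ind: x => s c d; rewrite [X in _ = X]/+%R /= -!tclassE.
exact/tclassP/tcong_scaleDl.
Qed.

HB.instance Definition _ := GRing.Zmodule_isLmodule.Build k tensor
  tens_scaleA tens_scale1 tens_scaleDr tens_scaleDl.

Definition tens (a : A) (b : B) : tensor := tclass (TPure a b).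

Lemma tensDl a a' b : tens (a + a') b = tens a b + tens a' b.
Proof. rewrite /+%R /= -tclass_add; exact/tclassP/tcong_pureDl. Qed.
Lemma tensDr a b b' : tens a (b + b') = tens a b + tens a b'.
Proof. rewrite [X in _ = X]/+%R /= -tclass_add; exact/tclassP/tcong_pureDr. Qed.
Lemma tensZl c a b : tens (c *: a) b = c *: tens a b.
Proof. rewrite [X in _ = X]/*:%R /= -tclass_scale; exact/tclassP/tcong_pureZl. Qed.
Lemma tensZr c a b : tens a (c *: b) = c *: tens a b.
Proof. rewrite [X in _ = X]/*:%R /= -tclass_scale; exact/tclassP/tcong_pureZr. Qed.

Lemma tens0l b : tens 0 b = 0.
Proof. by have := tensZl 0 0 b; rewrite !scale0r. Qed.
Lemma tens0r a : tens a 0 = 0.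
Proof. by have := tensZr 0 a 0; rewrite !scale0r. Qed.

Lemma tens_ind (P : tensor -> Prop) :
    (forall a b, P (tens a b)) -> P 0 -> (forall x y, P x -> P y -> P (x + y)) ->
    (forall c x, P x -> P (c *: x)) ->
  forall x, P x.
Proof.
move=> Pt P0 PD PZ; elim/tensor_repr_ind; elim=> [a b||s Ps|s Ps t Pt'|c s Ps].
- exact: Pt.
- exact: P0.
- rewrite tclass_opp -[tens_opp _]/(- tclass s) -scaleN1r; exact: PZ.
- rewrite tclass_add; exact: PD.
- rewrite tclass_scale; exact: PZ.
Qed.

Section Lift.
Variables (V : lmodType k) (g : A -> B -> V).

Fixpoint teval (s : tterm) : V :=
  match s with
  | TPure a b => g a b
  | TZero => 0
  | TOpp s => - teval s
  | TAdd s t => teval s + teval t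
  | TScale c s => c *: teval s
  end.

Definition tens_lift (x : tensor) : V := teval (repr x).

Definition is_bilinear_map : Prop :=
  [/\ forall a a' b, g (a + a') b = g a b + g a' b,
      forall a b b', g a (b + b') = g a b + g a b',
      forall c a b, g (c *: a) b = c *: g a b
    & forall c a b, g a (c *: b) = c *: g a b].

Hypothesis g_bilin : is_bilinear_map.

Lemma teval_cong s t : tcong s t -> teval s = teval t.
Proof.
case: g_bilin => gDl gDr gZl gZr.
elim=> {s t} //=.
- by move=> s t r _ -> _ ->.
- by move=> s s' _ ->.
- by move=> s s' t t' _ -> _ ->.
- by move=> c s s' _ ->.
- by move=> s t r; rewrite addrA.
- by move=> s t; rewrite addrC.
- by move=> s; rewrite add0r.
- by move=> s; rewrite addNr.
- by move=> c d s; rewrite scalerA.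
- by move=> s; rewrite scale1r.
- by move=> c s t; rewrite scalerDr.
- by move=> s c d; rewrite scalerDl.
Qed.

Lemma tens_lift_class s : tens_lift (tclass s) = teval s.
Proof. exact/teval_cong/tcong_repr. Qed.

Lemma tens_liftE a b : tens_lift (tens a b) = g a b.
Proof. exact: tens_lift_class. Qed.

Lemma tens_liftD x y : tens_lift (x + y) = tens_lift x + tens_lift y.
Proof.
elim/tensor_repr_ind: x => s; elim/tensor_repr_ind: y => t.
rewrite [X in tens_lift X]/+%R /= -tclass_add.
by rewrite !tens_lift_class.
Qed.

Lemma tens_liftZ c x : tens_lift (c *: x) = c *: tens_lift x.
Proof.
elim/tensor_repr_ind: x => s; rewrite [X in tens_lift X]/*:%R /= -tclass_scale.
by rewrite !tens_lift_class.
Qed.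

Lemma tens_lift_linear : linear tens_lift.
Proof. by move=> c x y; rewrite tens_liftD tens_liftZ. Qed.

Lemma tens_lift0 : tens_lift 0 = 0.
Proof. by have := tens_liftZ 0 0; rewrite !scale0r. Qed.

End Lift.
End Tensor.

Arguments tens {k A B} a b.

Notation "A ⊗ B" := (tensor A B) (at level 40, left associativity) : type_scope.
Notation "a ⊗ b" := (tens a b) (at level 40, left associativity) : ring_scope.

Section TensorAlgebra.
Variables (k : fieldType) (A B : assocAlgType k).
Implicit Types x y z : (A ⊗ B)%type.

Definition tens_mulp (a : A) (b : B) : (A ⊗ B)%type -> (A ⊗ B)%type :=
  tens_lift (fun a' b' => (a ** a') ⊗ (b ** b')).

Definition tens_mul x y : (A ⊗ B)%type :=
  tens_lift (fun a b => tens_mulp a b y) x.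

Lemma tens_mulp_bilin a b :
  is_bilinear_map (fun (a' : A) (b' : B) => (a ** a') ⊗ (b ** b')).
Proof.
by split=> *; rewrite ?amulDr ?tensDl ?tensDr -?ascalerAr ?tensZl ?tensZr.
Qed.

Lemma tens_mul_bilin y : is_bilinear_map (fun a b => tens_mulp a b y).
Proof.
have tl := tens_liftE (tens_mulp_bilin _ _).
have tD := tens_liftD (tens_mulp_bilin _ _).
have tZ := tens_liftZ (tens_mulp_bilin _ _).
have t0 := tens_lift0 (tens_mulp_bilin _ _).
split.
- move=> a a' b; elim/tens_ind: y => [c d||x y Hx Hy|e x Hx]; rewrite /tens_mulp.
  + by rewrite !tl amulDl tensDl.
  + by rewrite !t0 addr0.
  + by rewrite !tD addrACA -[LHS]/(tens_mulp _ _ _ + tens_mulp _ _ _) Hx Hy.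
  + by rewrite !tZ -scalerDr -[in LHS]/(tens_mulp _ _ _) Hx.
- move=> a b b'; elim/tens_ind: y => [c d||x y Hx Hy|e x Hx]; rewrite /tens_mulp.
  + by rewrite !tl amulDl tensDr.
  + by rewrite !t0 addr0.
  + by rewrite !tD addrACA -[LHS]/(tens_mulp _ _ _ + tens_mulp _ _ _) Hx Hy.
  + by rewrite !tZ -scalerDr -[in LHS]/(tens_mulp _ _ _) Hx.
- move=> c a b; elim/tens_ind: y => [c' d||x y Hx Hy|e x Hx]; rewrite /tens_mulp.
  + by rewrite !tl -ascalerAl tensZl.
  + by rewrite !t0 scaler0.
  + by rewrite !tD scalerDr -[LHS]/(tens_mulp _ _ _ + tens_mulp _ _ _) Hx Hy.
  + by rewrite !tZ scalerA mulrC -scalerA -[in LHS]/(tens_mulp _ _ _) Hx.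
- move=> c a b; elim/tens_ind: y => [c' d||x y Hx Hy|e x Hx]; rewrite /tens_mulp.
  + by rewrite !tl -ascalerAl tensZr.
  + by rewrite !t0 scaler0.
  + by rewrite !tD scalerDr -[LHS]/(tens_mulp _ _ _ + tens_mulp _ _ _) Hx Hy.
  + by rewrite !tZ scalerA mulrC -scalerA -[in LHS]/(tens_mulp _ _ _) Hx.
Qed.

Lemma tens_mulE a b a' b' :
  tens_mul (a ⊗ b) (a' ⊗ b') = (a ** a') ⊗ (b ** b').
Proof.
rewrite /tens_mul (tens_liftE (tens_mul_bilin _)).
exact: tens_liftE (tens_mulp_bilin _ _) _ _.
Qed.

Lemma tens_mulDl : left_distributive tens_mul +%R.
Proof. by move=> x y z; apply: tens_liftD (tens_mul_bilin _) _ _. Qed.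

Lemma tens_mulZl (c : k) x y : c *: tens_mul x y = tens_mul (c *: x) y.
Proof. by rewrite /tens_mul (tens_liftZ (tens_mul_bilin _)). Qed.

Lemma tens_mul0l y : tens_mul 0 y = 0.
Proof. exact: tens_lift0 (tens_mul_bilin _). Qed.

Lemma tens_mulDr : right_distributive tens_mul +%R.
Proof.
move=> x y z; elim/tens_ind: x => [a b||x x' Hx Hx'|e x Hx].
- rewrite /tens_mul !(tens_liftE (tens_mul_bilin _)).
  exact: tens_liftD (tens_mulp_bilin _ _) _ _.
- by rewrite !tens_mul0l addr0.
- by rewrite !tens_mulDl Hx Hx' addrACA.
- by rewrite -!tens_mulZl Hx scalerDr.
Qed.

Lemma tens_mulZr (c : k) x y : c *: tens_mul x y = tens_mul x (c *: y).
Proof.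
elim/tens_ind: x => [a b||x x' Hx Hx'|e x Hx].
- rewrite /tens_mul !(tens_liftE (tens_mul_bilin _)).
  by rewrite /tens_mulp (tens_liftZ (tens_mulp_bilin _ _)).
- by rewrite !tens_mul0l scaler0.
- by rewrite !tens_mulDl scalerDr Hx Hx'.
- by rewrite -!tens_mulZl -Hx !scalerA mulrC.
Qed.

Lemma tens_mul0r x : tens_mul x 0 = 0.
Proof. by have := tens_mulZr 0 x 0; rewrite !scale0r. Qed.

Lemma tens_mulA : associative tens_mul.
Proof.
move=> x y z; elim/tens_ind: x => [a b||x x' Hx Hx'|e x Hx]; last 3 first.
- by rewrite !tens_mul0l.
- by rewrite !tens_mulDl Hx Hx'.
- by rewrite -!tens_mulZl Hx.
elim/tens_ind: y => [a' b'||y y' Hy Hy'|e y Hy]; last 3 first.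
- by rewrite tens_mul0l tens_mul0r tens_mul0l.
- by rewrite !(tens_mulDl, tens_mulDr) Hy Hy'.
- by rewrite -?(tens_mulZl, tens_mulZr) Hy.
elim/tens_ind: z => [a'' b''||z z' Hz Hz'|e z Hz].
- by rewrite !tens_mulE !amulA.
- by rewrite !tens_mul0r.
- by rewrite !tens_mulDr Hz Hz'.
- by rewrite -!tens_mulZr Hz.
Qed.

HB.instance Definition _ := Lmodule_isAssocAlgebra.Build k (A ⊗ B)%type
  tens_mulA tens_mulDl tens_mulDr tens_mulZl tens_mulZr.

End TensorAlgebra.

Section TensorMap.
Variables (k : fieldType) (A A' B B' : assocAlgType k).
Variables (g : {alghom A -> A'}) (h : {alghom B -> B'}).

Definition tens_map : (A ⊗ B)%type -> (A' ⊗ B')%type :=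
  tens_lift (fun a b => g a ⊗ h b).

Lemma tens_map_bilin : is_bilinear_map (fun a b => g a ⊗ h b).
Proof.
split=> *; rewrite ?linearD ?linearZ /=;
  by rewrite ?tensDl ?tensDr ?tensZl ?tensZr.
Qed.

Lemma tens_mapE a b : tens_map (a ⊗ b) = g a ⊗ h b.
Proof. exact: tens_liftE tens_map_bilin _ _. Qed.

Lemma tens_map_linear : linear tens_map.
Proof. exact: tens_lift_linear tens_map_bilin. Qed.

HB.instance Definition _ := GRing.isLinear.Build k (A ⊗ B)%type (A' ⊗ B')%type
  *:%R tens_map tens_map_linear.

Lemma tens_mapM : {morph tens_map : x y / x ** y}.
Proof.
move=> x y; elim/tens_ind: x => [a b||x x' Hx Hx'|e x Hx]; last 3 first.
- by rewrite !(amul0l, linear0).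
- by rewrite amulDl !linearD /= amulDl Hx Hx'.
- by rewrite -ascalerAl !linearZ /= -ascalerAl Hx.
elim/tens_ind: y => [a' b'||y y' Hy Hy'|e y Hy].
- by rewrite /amul /= tens_mulE !tens_mapE tens_mulE !amorphM.
- by rewrite !(amul0r, linear0).
- by rewrite amulDr !linearD /= amulDr Hy Hy'.
- by rewrite -ascalerAr !linearZ /= -ascalerAr Hy.
Qed.

HB.instance Definition _ :=
  isAmulMorphism.Build k (A ⊗ B)%type (A' ⊗ B')%type tens_map tens_mapM.

Definition tens_hom : {alghom A ⊗ B -> A' ⊗ B'} := tens_map.

Lemma tens_homE a b : tens_hom (a ⊗ b) = g a ⊗ h b.
Proof. exact: tens_mapE. Qed.

End TensorMap.

Section Laurent.
Variable k : fieldType.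

Local Notation "p %:F" := (@FracField.tofrac {poly k} p).

(* k[u, u^-1], as the subring of the rational functions whose denominators are
   powers of the variable. *)
Definition laurent_pred : {pred {fraction {poly k}}} :=
  fun x => `[< exists (p : {poly k}) (n : nat), x = p%:F / 'X%:F ^+ n >].

Record laurent := Laurent {
  laurent_val :> {fraction {poly k}}; _ : laurent_val \in laurent_pred }.

HB.instance Definition _ := [isSub for laurent_val].
HB.instance Definition _ := [Choice of laurent by <:].

Lemma polyX_frac_neq0 : ('X : {poly k})%:F != 0.
Proof. by rewrite tofrac_eq0 polyX_eq0. Qed.

Lemma laurent_subring : subring_closed laurent_pred.
Proof.
have X0 n : ('X : {poly k})%:F ^+ n != 0 by rewrite expf_neq0 ?polyX_frac_neq0.
split.
- by apply/asboolP; exists 1, 0; rewrite expr0 divr1 tofrac1.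
- move=> _ _ /asboolP[p [m ->]] /asboolP[q [n ->]]; apply/asboolP.
  exists (p * 'X^n - q * 'X^m), (m + n)%N.
  rewrite exprD tofracB !tofracM !tofracXn -[in LHS]mulNr addf_div; [|exact: X0..].
  by congr ((_ + _) / _); apply: mulNr.
- move=> _ _ /asboolP[p [m ->]] /asboolP[q [n ->]]; apply/asboolP.
  by exists (p * q), (m + n)%N; rewrite exprD tofracM mulf_div.
Qed.

HB.instance Definition _ := GRing.SubChoice_isSubComNzRing.Build
  {fraction {poly k}} laurent_pred laurent laurent_subring.

Fact laurentC_subproof (c : k) : c%:P%:F \in laurent_pred.
Proof. by apply/asboolP; exists c%:P, 0; rewrite expr0 divr1. Qed.

Definition laurentC (c : k) : laurent := Laurent (laurentC_subproof c).

Definition laurent_scale (c : k) (x : laurent) : laurent := laurentC c * x.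

Lemma laurent_scaleA c d x :
  laurent_scale c (laurent_scale d x) = laurent_scale (c * d) x.
Proof.
rewrite /laurent_scale mulrA; congr (_ * _).
by apply/val_inj; rewrite rmorphM /= polyCM tofracM.
Qed.
Lemma laurent_scale1 : left_id 1 laurent_scale.
Proof.
move=> x; rewrite /laurent_scale -[RHS]mul1r; congr (_ * _).
by apply/val_inj; rewrite rmorph1 /= polyC1 tofrac1.
Qed.
Lemma laurent_scaleDr : right_distributive laurent_scale +%R.
Proof. by move=> c x y; rewrite /laurent_scale mulrDr. Qed.
Lemma laurent_scaleDl x : {morph laurent_scale^~ x : c d / c + d}.
Proof.
move=> c d; rewrite /laurent_scale -mulrDl; congr (_ * _).
by apply/val_inj; rewrite rmorphD /= polyCD tofracD.
Qed.

HB.instance Definition _ := GRing.Zmodule_isLmodule.Build k laurent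
  laurent_scaleA laurent_scale1 laurent_scaleDr laurent_scaleDl.

Lemma laurent_scaleAl (c : k) (x y : laurent) : c *: (x * y) = (c *: x) * y.
Proof. by rewrite /*:%R /= /laurent_scale mulrA. Qed.
HB.instance Definition _ :=
  GRing.Lmodule_isLalgebra.Build k laurent laurent_scaleAl.
HB.instance Definition _ := GRing.Lalgebra_isComAlgebra.Build k laurent.

HB.instance Definition _ := Lmodule_isAssocAlgebra.Build k laurent
  (@mulrA laurent) (@mulrDl laurent) (@mulrDr laurent)
  (@scalerAl k laurent) (@scalerAr k laurent).

Fact laurentX_subproof (n : int) : ('X : {poly k})%:F ^ n \in laurent_pred.
Proof.
apply/asboolP; case: n => n.
  by exists 'X^n, 0; rewrite expr0 divr1 -exprnP tofracXn.
by exists 1, n.+1; rewrite tofrac1 div1r NegzE exprnN.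
Qed.

(* The power u^n of the variable. *)
Definition laurentX (n : int) : laurent := Laurent (laurentX_subproof n).

Lemma laurentXD m n : laurentX (m + n) = laurentX m ** laurentX n.
Proof. by apply/val_inj; rewrite /= expfzDr // polyX_frac_neq0. Qed.

Lemma laurentX0 : laurentX 0 = 1.
Proof. exact/val_inj. Qed.

End Laurent.

(* Finite graphs only. *)
Record graph := Graph {
  vertex : finType;
  edge : finType;
  source : edge -> vertex;
  target : edge -> vertex }.

Record subgraph (Q : graph) := Subgraph {
  sub_vertex : {set vertex Q};
  sub_edge : {set edge Q};
  sub_source : forall e, e \in sub_edge -> source e \in sub_vertex;
  sub_target : forall e, e \in sub_edge -> target e \in sub_vertex }.

Definition graph_of_sub (Q : graph) (S : subgraph Q) : graph :=
  @Graph {v | v \in sub_vertex S} {e | e \in sub_edge S}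
    (fun e => exist _ (source (val e)) (sub_source (valP e)))
    (fun e => exist _ (target (val e)) (sub_target (valP e))).

Coercion graph_of_sub : subgraph >-> graph.

Section Graph.
Variable Q : graph.

Definition out_edges (v : vertex Q) : {set edge Q} := @source Q @^-1: [set v].
Definition in_edges (v : vertex Q) : {set edge Q} := @target Q @^-1: [set v].

Fact del_edge_subproof (f : edge Q -> vertex Q) (x0 e : edge Q) :
  e \in [set~ x0] -> f e \in [set: vertex Q].
Proof. by move=> _; rewrite inE. Qed.

Definition del_edge (x0 : edge Q) : subgraph Q :=
  Subgraph (del_edge_subproof (@source Q) (x0 := x0))
           (del_edge_subproof (@target Q) (x0 := x0)).

Record trimmable (Q' : subgraph Q) (v0 : vertex Q) (x0 : edge Q) : Prop := {
  trim_vertex : [set: vertex Q] = sub_vertex Q' :|: [set v0];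
  trim_notin : v0 \notin sub_vertex Q';
  trim_edge : [set: edge Q] = sub_edge Q' :|: in_edges v0;
  trim_out : out_edges v0 = [set x0];
  trim_loop : target x0 = v0;
  trim_in : in_edges v0 :\ x0 != set0;
  trim_emit : forall v, v \in @source Q @: (in_edges v0 :\ x0) ->
    out_edges v :\: in_edges v0 != set0 }.

Inductive generator :=
  | GVertex of vertex Q
  | GEdge of edge Q
  | GGhost of edge Q.

Definition gdegree (g : generator) : int :=
  match g with GVertex _ => 0 | GEdge _ => 1 | GGhost _ => -1 end.

End Graph.

Section LeavittPathAlgebra.
Variables (k : fieldType) (Q : graph).

(* Formal expressions in the generators, and the least congruence making them
   an associative k-algebra that satisfies the Leavitt path algebra relations.
   As Q is finite, the last relation applies to every vertex that emits an
   edge. *)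
Inductive lterm :=
  | LGen of generator Q
  | LZero
  | LOpp of lterm
  | LAdd of lterm & lterm
  | LScale of k & lterm
  | LMul of lterm & lterm.

Notation Vx v := (LGen (GVertex v)).
Notation Ed e := (LGen (GEdge e)).
Notation Gh e := (LGen (GGhost e)).

Inductive lcong : lterm -> lterm -> Prop :=
  | lcong_refl s : lcong s s
  | lcong_sym s t : lcong s t -> lcong t s
  | lcong_trans s t r : lcong s t -> lcong t r -> lcong s r
  | lcong_opp s s' : lcong s s' -> lcong (LOpp s) (LOpp s')
  | lcong_add s s' t t' :
      lcong s s' -> lcong t t' -> lcong (LAdd s t) (LAdd s' t')
  | lcong_scale c s s' : lcong s s' -> lcong (LScale c s) (LScale c s')
  | lcong_mul s s' t t' :
      lcong s s' -> lcong t t' -> lcong (LMul s t) (LMul s' t')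
  | lcong_addA s t r : lcong (LAdd s (LAdd t r)) (LAdd (LAdd s t) r)
  | lcong_addC s t : lcong (LAdd s t) (LAdd t s)
  | lcong_add0 s : lcong (LAdd LZero s) s
  | lcong_addN s : lcong (LAdd (LOpp s) s) LZero
  | lcong_scaleA c d s :
      lcong (LScale c (LScale d s)) (LScale (c * d) s)
  | lcong_scale1 s : lcong (LScale 1 s) s
  | lcong_scaleDr c s t :
      lcong (LScale c (LAdd s t)) (LAdd (LScale c s) (LScale c t))
  | lcong_scaleDl s c d :
      lcong (LScale (c + d) s) (LAdd (LScale c s) (LScale d s))
  | lcong_mulA s t r : lcong (LMul s (LMul t r)) (LMul (LMul s t) r)
  | lcong_mulDl s t r :
      lcong (LMul (LAdd s t) r) (LAdd (LMul s r) (LMul t r))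
  | lcong_mulDr s t r :
      lcong (LMul s (LAdd t r)) (LAdd (LMul s t) (LMul s r))
  | lcong_mulZl c s t : lcong (LScale c (LMul s t)) (LMul (LScale c s) t)
  | lcong_mulZr c s t : lcong (LScale c (LMul s t)) (LMul s (LScale c t))
  | lcong_vertex v w : lcong (LMul (Vx v) (Vx w)) (if v == w then Vx v else LZero)
  | lcong_source_edge e : lcong (LMul (Vx (source e)) (Ed e)) (Ed e)
  | lcong_edge_target e : lcong (LMul (Ed e) (Vx (target e))) (Ed e)
  | lcong_target_ghost e : lcong (LMul (Vx (target e)) (Gh e)) (Gh e)
  | lcong_ghost_source e : lcong (LMul (Gh e) (Vx (source e))) (Gh e)
  | lcong_CK1 e f :
      lcong (LMul (Gh e) (Ed f)) (if e == f then Vx (target e) else LZero)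
  | lcong_CK2 v : out_edges v != set0 ->
      lcong (\big[LAdd/LZero]_(e in out_edges v) LMul (Ed e) (Gh e)) (Vx v).

HB.instance Definition _ := gen_eqMixin lterm.
HB.instance Definition _ := gen_choiceMixin lterm.

Definition lcongb : rel lterm := fun s t => `[< lcong s t >].

Lemma lcongb_refl : reflexive lcongb.
Proof. by move=> s; apply/asboolP/lcong_refl. Qed.
Lemma lcongb_sym : symmetric lcongb.
Proof. by move=> s t; apply/asbool_equiv_eq; split; apply: lcong_sym. Qed.
Lemma lcongb_trans : transitive lcongb.
Proof.
move=> t s r /asboolP st /asboolP tr; apply/asboolP.
exact: lcong_trans st tr.
Qed.

Canonical lcong_equiv := EquivRel lcongb lcongb_refl lcongb_sym lcongb_trans.

Definition leavitt := {eq_quot lcong_equiv}.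
HB.instance Definition _ : EqQuotient _ lcong_equiv leavitt :=
  EqQuotient.on leavitt.
HB.instance Definition _ := Choice.on leavitt.

Definition lclass (s : lterm) : leavitt := \pi_leavitt s.

Lemma lclassP s t : lclass s = lclass t <-> lcong s t.
Proof.
split=> [/eqmodP/asboolP //|st]; apply/eqmodP.
exact/asboolP.
Qed.

Lemma lclass_repr (x : leavitt) : lclass (repr x) = x.
Proof. exact: reprK. Qed.

Lemma lcong_repr s : lcong (repr (lclass s)) s.
Proof. by apply/lclassP; rewrite lclass_repr. Qed.

Lemma leavitt_repr_ind (P : leavitt -> Prop) :
  (forall s, P (lclass s)) -> forall x, P x.
Proof. by move=> Ps x; rewrite -[x]lclass_repr. Qed.

Definition leavitt_opp (x : leavitt) : leavitt := lclass (LOpp (repr x)).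
Definition leavitt_add (x y : leavitt) : leavitt :=
  lclass (LAdd (repr x) (repr y)).
Definition leavitt_scale (c : k) (x : leavitt) : leavitt :=
  lclass (LScale c (repr x)).
Definition leavitt_mul (x y : leavitt) : leavitt :=
  lclass (LMul (repr x) (repr y)).

Lemma lclass_opp s : lclass (LOpp s) = leavitt_opp (lclass s).
Proof. by apply/lclassP/lcong_opp/lcong_sym/lcong_repr. Qed.
Lemma lclass_add s t :
  lclass (LAdd s t) = leavitt_add (lclass s) (lclass t).
Proof. by apply/lclassP/lcong_add; apply/lcong_sym/lcong_repr. Qed.
Lemma lclass_scale c s :
  lclass (LScale c s) = leavitt_scale c (lclass s).
Proof. by apply/lclassP/lcong_scale/lcong_sym/lcong_repr. Qed.
Lemma lclass_mul s t :
  lclass (LMul s t) = leavitt_mul (lclass s) (lclass t).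
Proof. by apply/lclassP/lcong_mul; apply/lcong_sym/lcong_repr. Qed.

Definition lclassE := (lclass_opp, lclass_add, lclass_scale, lclass_mul).

Lemma leavitt_addA : associative leavitt_add.
Proof.
elim/leavitt_repr_ind=> s; elim/leavitt_repr_ind=> t.
elim/leavitt_repr_ind=> r; rewrite -!lclassE; exact/lclassP/lcong_addA.
Qed.
Lemma leavitt_addC : commutative leavitt_add.
Proof.
elim/leavitt_repr_ind=> s; elim/leavitt_repr_ind=> t.
rewrite -!lclassE; exact/lclassP/lcong_addC.
Qed.
Lemma leavitt_add0 : left_id (lclass LZero) leavitt_add.
Proof.
elim/leavitt_repr_ind=> s; rewrite -!lclassE; exact/lclassP/lcong_add0.
Qed.
Lemma leavitt_addN : left_inverse (lclass LZero) leavitt_opp leavitt_add.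
Proof.
elim/leavitt_repr_ind=> s; rewrite -!lclassE; exact/lclassP/lcong_addN.
Qed.

HB.instance Definition _ := GRing.isZmodule.Build leavitt
  leavitt_addA leavitt_addC leavitt_add0 leavitt_addN.

Lemma leavitt_scaleA c d (x : leavitt) :
  leavitt_scale c (leavitt_scale d x) = leavitt_scale (c * d) x.
Proof.
elim/leavitt_repr_ind: x => s; rewrite -!lclassE.
exact/lclassP/lcong_scaleA.
Qed.
Lemma leavitt_scale1 : left_id 1 leavitt_scale.
Proof.
elim/leavitt_repr_ind=> s; rewrite -!lclassE; exact/lclassP/lcong_scale1.
Qed.
Lemma leavitt_scaleDr : right_distributive leavitt_scale +%R.
Proof.
move=> c; elim/leavitt_repr_ind=> s; elim/leavitt_repr_ind=> t.
rewrite /+%R /= -!lclassE; exact/lclassP/lcong_scaleDr.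
Qed.
Lemma leavitt_scaleDl (x : leavitt) :
  {morph leavitt_scale^~ x : c d / c + d >-> c + d}.
Proof.
elim/leavitt_repr_ind: x => s c d; rewrite [X in _ = X]/+%R /= -!lclassE.
exact/lclassP/lcong_scaleDl.
Qed.

HB.instance Definition _ := GRing.Zmodule_isLmodule.Build k leavitt
  leavitt_scaleA leavitt_scale1 leavitt_scaleDr leavitt_scaleDl.

Lemma leavitt_mulA : associative leavitt_mul.
Proof.
elim/leavitt_repr_ind=> s; elim/leavitt_repr_ind=> t.
elim/leavitt_repr_ind=> r; rewrite -!lclassE; exact/lclassP/lcong_mulA.
Qed.
Lemma leavitt_mulDl : left_distributive leavitt_mul +%R.
Proof.
elim/leavitt_repr_ind=> s; elim/leavitt_repr_ind=> t.
elim/leavitt_repr_ind=> r; rewrite /+%R /= -!lclassE.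
exact/lclassP/lcong_mulDl.
Qed.
Lemma leavitt_mulDr : right_distributive leavitt_mul +%R.
Proof.
elim/leavitt_repr_ind=> s; elim/leavitt_repr_ind=> t.
elim/leavitt_repr_ind=> r; rewrite /+%R /= -!lclassE.
exact/lclassP/lcong_mulDr.
Qed.
Lemma leavitt_mulZl (c : k) (x y : leavitt) :
  c *: leavitt_mul x y = leavitt_mul (c *: x) y.
Proof.
elim/leavitt_repr_ind: x => s; elim/leavitt_repr_ind: y => t.
rewrite /*:%R /= -!lclassE; exact/lclassP/lcong_mulZl.
Qed.
Lemma leavitt_mulZr (c : k) (x y : leavitt) :
  c *: leavitt_mul x y = leavitt_mul x (c *: y).
Proof.
elim/leavitt_repr_ind: x => s; elim/leavitt_repr_ind: y => t.
rewrite /*:%R /= -!lclassE; exact/lclassP/lcong_mulZr.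
Qed.

HB.instance Definition _ := Lmodule_isAssocAlgebra.Build k leavitt
  leavitt_mulA leavitt_mulDl leavitt_mulDr leavitt_mulZl leavitt_mulZr.

Definition lgen (g : generator Q) : leavitt := lclass (LGen g).

(* The standard grading: the least family of subspaces containing the
   generators in their degrees and compatible with the product. *)
Inductive leavitt_homog : int -> leavitt -> Prop :=
  | lhomog_gen g : leavitt_homog (gdegree g) (lgen g)
  | lhomog0 n : leavitt_homog n 0
  | lhomogD n x y :
      leavitt_homog n x -> leavitt_homog n y -> leavitt_homog n (x + y)
  | lhomogZ n c x : leavitt_homog n x -> leavitt_homog n (c *: x)
  | lhomogM m n x y :
      leavitt_homog m x -> leavitt_homog n y -> leavitt_homog (m + n) (x ** y).

Lemma leavitt_ind (P : leavitt -> Prop) :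
    (forall g, P (lgen g)) -> P 0 -> (forall x y, P x -> P y -> P (x + y)) ->
    (forall c x, P x -> P (c *: x)) ->
    (forall x y, P x -> P y -> P (x ** y)) ->
  forall x, P x.
Proof.
move=> Pg P0 PD PZ PM; elim/leavitt_repr_ind.
elim=> [g||s Ps|s Ps t Pt|c s Ps|s Ps t Pt].
- exact: Pg.
- exact: P0.
- rewrite lclass_opp -[leavitt_opp _]/(- lclass s) -scaleN1r; exact: PZ.
- rewrite lclass_add; exact: PD.
- rewrite lclass_scale; exact: PZ.
- rewrite lclass_mul; exact: PM.
Qed.

Section Lift.
Variables (A : assocAlgType k) (g : generator Q -> A).

Definition leavitt_relations : Prop :=
  [/\ forall v w, g (GVertex v) ** g (GVertex w)
                  = if v == w then g (GVertex v) else 0,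
      forall e, g (GVertex (source e)) ** g (GEdge e) = g (GEdge e)
             /\ g (GEdge e) ** g (GVertex (target e)) = g (GEdge e),
      forall e, g (GVertex (target e)) ** g (GGhost e) = g (GGhost e)
             /\ g (GGhost e) ** g (GVertex (source e)) = g (GGhost e),
      forall e f, g (GGhost e) ** g (GEdge f)
                  = if e == f then g (GVertex (target e)) else 0
    & forall v, out_edges v != set0 ->
        \sum_(e in out_edges v) g (GEdge e) ** g (GGhost e) = g (GVertex v)].

Fixpoint leval (s : lterm) : A :=
  match s with
  | LGen x => g x
  | LZero => 0
  | LOpp s => - leval s
  | LAdd s t => leval s + leval t
  | LScale c s => c *: leval s
  | LMul s t => leval s ** leval t
  end.

Hypothesis g_rel : leavitt_relations.

Lemma leval_cong s t : lcong s t -> leval s = leval t.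
Proof.
case: g_rel => r1 r2 r3 r4 r5.
elim=> {s t} //=.
- by move=> s t r _ -> _ ->.
- by move=> s s' _ ->.
- by move=> s s' t t' _ -> _ ->.
- by move=> c s s' _ ->.
- by move=> s s' t t' _ -> _ ->.
- by move=> s t r; rewrite addrA.
- by move=> s t; rewrite addrC.
- by move=> s; rewrite add0r.
- by move=> s; rewrite addNr.
- by move=> c d s; rewrite scalerA.
- by move=> s; rewrite scale1r.
- by move=> c s t; rewrite scalerDr.
- by move=> s c d; rewrite scalerDl.
- by move=> s t r; rewrite amulA.
- by move=> s t r; rewrite amulDl.
- by move=> s t r; rewrite amulDr.
- by move=> c s t; rewrite ascalerAl.
- by move=> c s t; rewrite ascalerAr.
- by move=> v w; rewrite r1; case: ifP.
- by move=> e; case: (r2 e).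
- by move=> e; case: (r2 e).
- by move=> e; case: (r3 e).
- by move=> e; case: (r3 e).
- by move=> e f; rewrite r4; case: ifP.
- by move=> v /r5 <-; elim/big_rec2: _ => //= e x y _ <-.
Qed.

(* The universal property of the Leavitt path algebra. *)
Definition leavitt_lift of leavitt_relations : leavitt -> A :=
  fun x => leval (repr x).

Local Notation lift := (leavitt_lift g_rel).

Lemma leavitt_lift_class s : lift (lclass s) = leval s.
Proof. exact/leval_cong/lcong_repr. Qed.

Lemma leavitt_liftE x : lift (lgen x) = g x.
Proof. exact: leavitt_lift_class. Qed.

Lemma leavitt_lift_linear : linear lift.
Proof.
move=> c x y; elim/leavitt_repr_ind: x => s; elim/leavitt_repr_ind: y => t.
have -> : c *: lclass s + lclass t = lclass (LAdd (LScale c s) t).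
  by rewrite !lclassE.
by rewrite !leavitt_lift_class.
Qed.

Lemma leavitt_liftM : {morph lift : x y / x ** y}.
Proof.
move=> x y; elim/leavitt_repr_ind: x => s; elim/leavitt_repr_ind: y => t.
have -> : lclass s ** lclass t = lclass (LMul s t) by rewrite !lclassE.
by rewrite !leavitt_lift_class.
Qed.

HB.instance Definition _ :=
  GRing.isLinear.Build k leavitt A *:%R lift leavitt_lift_linear.
HB.instance Definition _ := isAmulMorphism.Build k leavitt A lift leavitt_liftM.

End Lift.

Lemma leavitt_lgen_relations : leavitt_relations lgen.
Proof.
split.
- move=> v w; rewrite -[LHS]lclass_mul ((lclassP _ _).2 (lcong_vertex v w)).
  by case: ifP.
- by move=> e; split; rewrite -[LHS]lclass_mul; apply/lclassP; constructor.
- by move=> e; split; rewrite -[LHS]lclass_mul; apply/lclassP; constructor.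
- move=> e f; rewrite -[LHS]lclass_mul ((lclassP _ _).2 (lcong_CK1 e f)).
  by case: ifP.
- move=> v /lcong_CK2 /lclassP E; rewrite -[RHS]E.
  elim/big_rec2: _ => [|e x s _ ->] //.
  by rewrite lclass_add lclass_mul.
Qed.

End LeavittPathAlgebra.

Arguments lgen {k Q} g.

Section GaugeCoaction.
Variables (k : fieldType) (Q : graph).

Definition delta_gen (g : generator Q) : (leavitt k Q ⊗ laurent k)%type :=
  match g with
  | GVertex _ => lgen g ⊗ 1
  | GEdge _ => lgen g ⊗ laurentX k 1
  | GGhost _ => lgen g ⊗ laurentX k (-1)
  end.

Lemma tens_amul (A B : assocAlgType k) (a a' : A) (b b' : B) :
  (a ⊗ b) ** (a' ⊗ b') = (a ** a') ⊗ (b ** b').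
Proof. exact: tens_mulE. Qed.

Lemma tens_sum (A B : lmodType k) I (r : seq I) (P : pred I) (F : I -> A)
    (b : B) :
  \sum_(i <- r | P i) (F i ⊗ b) = (\sum_(i <- r | P i) F i) ⊗ b.
Proof.
elim/big_rec2: _ => [|i x y _ ->]; first by rewrite tens0l.
by rewrite tensDl.
Qed.

Lemma laurent_mulX m n :
  laurentX k m ** laurentX k n = laurentX k (m + n) :> laurent k.
Proof. by rewrite laurentXD. Qed.

Lemma delta_relations : leavitt_relations delta_gen.
Proof.
case: (leavitt_lgen_relations k Q) => r1 r2 r3 r4 r5.
rewrite /delta_gen -!laurentX0; split.
- move=> v w; rewrite tens_amul laurent_mulX r1.
  by case: ifP => //; rewrite tens0l.
- by move=> e; case: (r2 e) => E F; split; rewrite tens_amul laurent_mulX ?E ?F.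
- by move=> e; case: (r3 e) => E F; split; rewrite tens_amul laurent_mulX ?E ?F.
- move=> e f; rewrite tens_amul laurent_mulX r4.
  by case: ifP => //; rewrite tens0l.
- move=> v /r5 <-; rewrite -tens_sum; apply: eq_bigr => e _.
  by rewrite tens_amul laurent_mulX.
Qed.

Definition delta : {alghom leavitt k Q -> leavitt k Q ⊗ laurent k} :=
  leavitt_lift delta_relations.

Lemma deltaE g : delta (lgen g) = delta_gen g.
Proof. exact: leavitt_liftE. Qed.

End GaugeCoaction.

Section SubgraphMaps.
Variables (k : fieldType) (Q : graph).

Definition sub_generator (S : subgraph Q) (g : generator S) : generator Q :=
  match g with
  | GVertex v => GVertex (val v)
  | GEdge e => GEdge (val e)
  | GGhost e => GGhost (val e)
  end.

(* [insub x] is [Some x] when x belongs to the subgraph, [None] otherwise. *)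
Definition restrict_gen (S : subgraph Q) (g : generator Q) : leavitt k S :=
  match g with
  | GVertex v => if insub v is Some v' then lgen (@GVertex S v') else 0
  | GEdge e => if insub e is Some e' then lgen (@GEdge S e') else 0
  | GGhost e => if insub e is Some e' then lgen (@GGhost S e') else 0
  end.

Section RestrictRelations.
Variables (S : subgraph Q) (P : graph).
Variables (iv : vertex P -> vertex Q) (ie : edge P -> edge Q).
Hypotheses (iv_inj : injective iv) (ie_inj : injective ie).
Hypothesis source_ie : forall e, source (ie e) = iv (source e).
Hypothesis target_ie : forall e, target (ie e) = iv (target e).
Variable je : edge S -> edge P.
Hypothesis jeK : forall e, ie (je e) = val e.
Hypothesis noenter : forall e,
  ie e \notin sub_edge S -> iv (target e) \notin sub_vertex S.
Hypothesis emit : forall v, iv v \in sub_vertex S -> out_edges v != set0 ->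
  exists2 e, source e = v & ie e \in sub_edge S.

Lemma restrict_relations (h : generator P -> leavitt k S) :
    (forall v, h (GVertex v) = restrict_gen S (GVertex (iv v))) ->
    (forall e, h (GEdge e) = restrict_gen S (GEdge (ie e))) ->
    (forall e, h (GGhost e) = restrict_gen S (GGhost (ie e))) ->
  leavitt_relations h.
Proof.
case: (leavitt_lgen_relations k S) => r1 r2 r3 r4 r5 hv he hg.
split=> [v w|e|e|e f|v].
- rewrite !hv /=; case: insubP => [v' _ Ev|nv]; last first.
    by rewrite amul0l; case: ifP.
  case: insubP => [w' _ Ew|nw]; last first.
    rewrite amul0r; case: eqP => // vw.
    by move: nw; rewrite -vw -Ev (valP v').
  by rewrite r1 -(inj_eq val_inj) Ev Ew (inj_eq iv_inj).
- rewrite he !hv /=; case: (insubP {e | e \in sub_edge S} (ie e)) => [e' _ Ee|ne]; last first.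
    by rewrite amul0r amul0l.
  have [sE tE] : iv (source e) = val (@source S e')
               /\ iv (target e) = val (@target S e').
    by rewrite -source_ie -target_ie -Ee.
  by rewrite sE tE !valK; apply: r2.
- rewrite hg !hv /=; case: (insubP {e | e \in sub_edge S} (ie e)) => [e' _ Ee|ne]; last first.
    by rewrite amul0r amul0l.
  have [sE tE] : iv (source e) = val (@source S e')
               /\ iv (target e) = val (@target S e').
    by rewrite -source_ie -target_ie -Ee.
  by rewrite sE tE !valK; apply: r3.
- rewrite he hg hv /=; case: insubP => [e' _ Ee|ne]; last first.
    rewrite amul0l; case: ifP => // _.
    by rewrite insubN // noenter.
  case: insubP => [f' _ Ef|nf]; last first.
    rewrite amul0r; case: eqP => // ef.
    by move: nf; rewrite -ef -Ee (valP e').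
  rewrite r4 -(inj_eq val_inj) Ee Ef (inj_eq ie_inj).
  case: ifP => // _.
  have -> : iv (target e) = val (@target S e') by rewrite -target_ie -Ee.
  by rewrite valK.
- move=> out_v; rewrite hv /=; case: insubP => [v' vS Ev|nv]; last first.
    apply: big1 => e; rewrite !inE => /eqP se; rewrite he hg /=.
    case: insubP => [e' _ Ee|ne]; last by rewrite amul0l.
    move: nv; rewrite -se -source_ie -Ee.
    by rewrite (sub_source (valP e')).
  rewrite -r5; last first.
    have [e se eS] := emit vS out_v.
    apply/set0Pn; exists (exist _ (ie e) eS).
    by rewrite !inE -(inj_eq val_inj) /= source_ie se Ev.
  rewrite (bigID (fun e => ie e \in sub_edge S)) /= addrC big1 ?add0r; last first.
    by move=> e /andP[_ ne]; rewrite he /= insubN // amul0l.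
  rewrite (reindex_omap je (fun e => insub (ie e))) /=; last first.
    move=> e /andP[_ eS]; case: insubP => [e' _ Ee|]; last by rewrite eS.
    by congr Some; apply: ie_inj; rewrite jeK.
  apply: eq_big => [e|e _]; last by rewrite he hg /= jeK valK.
  rewrite jeK valK eqxx andbT (valP e) andbT !inE.
  rewrite -(inj_eq val_inj) /= Ev -(inj_eq iv_inj) -source_ie jeK.
  by [].
Qed.

End RestrictRelations.

Variables (Q' : subgraph Q) (v0 : vertex Q) (x0 : edge Q).
Hypothesis T : trimmable Q' v0 x0.

Local Notation Q'' := (del_edge x0).

Lemma trim_edgeN e : e \notin sub_edge Q' -> target e = v0.
Proof.
move=> ne; have : e \in [set: edge Q] by rewrite inE.
by rewrite (trim_edge T) !inE (negPf ne) => /eqP.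
Qed.

Lemma trim_source_neq v e : v \in sub_vertex Q' -> source e = v -> e != x0.
Proof.
move=> vQ se; apply/eqP => ex; have := set11 x0.
rewrite -(trim_out T) !inE -ex se => /eqP vv0.
by move: vQ; rewrite vv0 (negPf (trim_notin T)).
Qed.

Lemma trim_edgeP v : v \in sub_vertex Q' -> out_edges v != set0 ->
  exists2 e, source e = v & e \in sub_edge Q'.
Proof.
move=> vQ /set0Pn[e]; rewrite !inE => /eqP se.
have [eQ|ne] := boolP (e \in sub_edge Q'); first by exists e.
have /(trim_emit T)/set0Pn[e'] : v \in @source Q @: (in_edges v0 :\ x0).
  apply/imsetP; exists e => //.
  by rewrite !inE (trim_edgeN ne) eqxx (trim_source_neq vQ se).
rewrite !inE => /andP[te' /eqP se']; exists e' => //.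
by apply: contraR te' => /trim_edgeN->.
Qed.

Lemma pi1_relations : leavitt_relations (restrict_gen Q').
Proof.
apply: (@restrict_relations Q' Q id id _ _ _ _ val) => //.
- by move=> e /trim_edgeN->; apply: trim_notin T.
- exact: trim_edgeP.
Qed.

Definition pi1 : {alghom leavitt k Q -> leavitt k Q'} :=
  leavitt_lift pi1_relations.

Lemma pi1E g : pi1 (lgen g) = restrict_gen Q' g.
Proof. exact: leavitt_liftE. Qed.

Fact trim_sub_edge (e : edge Q') : val e \in sub_edge Q''.
Proof.
rewrite !inE; exact: trim_source_neq (sub_source (valP e)) erefl.
Qed.

Definition pi2_gen (g : generator Q'') : leavitt k Q' :=
  restrict_gen Q' (sub_generator g).

Lemma pi2_relations : leavitt_relations pi2_gen.
Proof.
apply: (@restrict_relations Q' Q'' val val val_inj val_inj _ _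
          (fun e => exist _ (val e) (trim_sub_edge e))) => //.
- by move=> e /trim_edgeN /= ->; apply: trim_notin T.
- move=> v vQ /set0Pn[e]; rewrite !inE => /eqP se.
  have [e' se' eQ] : exists2 e', source e' = val v & e' \in sub_edge Q'.
    apply: trim_edgeP => //; apply/set0Pn; exists (val e).
    by rewrite !inE -se.
  exists (exist _ e' (trim_sub_edge (exist _ e' eQ))) => //.
  exact/val_inj.
Qed.

Definition pi2 : {alghom leavitt k Q'' -> leavitt k Q'} :=
  leavitt_lift pi2_relations.

Lemma pi2E g : pi2 (lgen g) = pi2_gen g.
Proof. exact: leavitt_liftE. Qed.

(* [insub e] is [None] exactly when e is the removed edge x0. *)
Definition f_gen (g : generator Q) : (leavitt k Q'' ⊗ laurent k)%type :=
  let vx (v : vertex Q) : leavitt k Q'' :=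
    lgen (@GVertex Q'' (exist _ v (in_setT v))) in
  match g with
  | GVertex v => vx v ⊗ 1
  | GEdge e =>
      (if insub e is Some e' then lgen (@GEdge Q'' e') else vx v0)
        ⊗ laurentX k 1
  | GGhost e =>
      (if insub e is Some e' then lgen (@GGhost Q'' e') else vx v0)
        ⊗ laurentX k (-1)
  end.

Lemma f_relations : leavitt_relations f_gen.
Proof.
case: (leavitt_lgen_relations k Q'') => r1 r2 r3 r4 r5.
have sx0 : source x0 = v0.
  by have := set11 x0; rewrite -(trim_out T) !inE => /eqP.
have out0 e : source e = v0 -> e = x0.
  move=> se; apply/set1P; rewrite -(trim_out T) !inE.
  exact/eqP.
have notx0 e : e \notin sub_edge Q'' -> e = x0.
  by rewrite !inE negbK => /eqP.
pose vx (v : vertex Q) : vertex Q'' := exist _ v (in_setT v).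
have vxE v w : (vx v == vx w) = (v == w) by rewrite -(inj_eq val_inj).
have sQ (e : edge Q'') : source e = vx (source (val e)) by apply: val_inj.
have tQ (e : edge Q'') : target e = vx (target (val e)) by apply: val_inj.
have ne0 (e : edge Q'') : source (val e) != v0.
  apply/eqP => /out0 ex; have := valP e.
  by rewrite ex !inE eqxx.
have ve (v : vertex Q) (e : edge Q'') : v != source (val e) ->
    lgen (GVertex (vx v)) ** lgen (GEdge e) = 0 :> leavitt k Q''.
  move=> vs; rewrite -(proj1 (r2 e)) amulA r1 sQ vxE.
  by rewrite (negPf vs) amul0l.
have ev (v : vertex Q) (e : edge Q'') : v != source (val e) ->
    lgen (GGhost e) ** lgen (GVertex (vx v)) = 0 :> leavitt k Q''.
  move=> vs; rewrite -(proj2 (r3 e)) -amulA r1 sQ vxE eq_sym.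
  by rewrite (negPf vs) amul0r.
rewrite /f_gen -!laurentX0; split=> [v w|e|e|e f|v].
- rewrite tens_amul laurent_mulX r1 vxE.
  by case: ifP => //; rewrite tens0l.
- case: insubP => [e' _ <-|/notx0->]; last first.
    by rewrite (trim_loop T) sx0 !tens_amul !laurent_mulX r1 eqxx.
  case: (r2 e'); rewrite sQ tQ => E F.
  by split; rewrite tens_amul laurent_mulX; congr (_ ⊗ _).
- case: insubP => [e' _ <-|/notx0->]; last first.
    by rewrite (trim_loop T) sx0 !tens_amul !laurent_mulX r1 eqxx.
  case: (r3 e'); rewrite sQ tQ => E F.
  by split; rewrite tens_amul laurent_mulX; congr (_ ⊗ _).
- rewrite tens_amul laurent_mulX.
  case: insubP => [e' eS Ee|/notx0->]; case: insubP => [f' fS Ef|/notx0->].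
  + rewrite r4 -(inj_eq val_inj) Ee Ef; case: ifP => _; last by rewrite tens0l.
    by rewrite tQ Ee.
  + rewrite ev 1?eq_sym //; case: eqP => [ex|]; rewrite ?tens0l //.
    by move: eS; rewrite ex !inE eqxx.
  + rewrite ve 1?eq_sym //; case: eqP => [ex|]; rewrite ?tens0l //.
    by move: fS; rewrite -ex !inE eqxx.
  + by rewrite r1 !eqxx (trim_loop T).
- move=> out_v; have [->|nv] := eqVneq v v0.
    rewrite (trim_out T) big_set1 insubN ?inE ?eqxx // tens_amul laurent_mulX.
    by rewrite r1 eqxx.
  rewrite -/(vx v) -(r5 (vx v)); last first.
    case/set0Pn: out_v => e; rewrite !inE => /eqP se.
    have eS : e \in sub_edge Q''.
      by rewrite !inE; apply: contra_neqT nv; rewrite negbK -se => /eqP->.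
    apply/set0Pn; exists (exist _ e eS).
    by rewrite !inE -(inj_eq val_inj) /= se.
  rewrite -tens_sum (reindex_omap (fun e : edge Q'' => val e) insub) /=; last first.
    move=> e; rewrite !inE => /eqP se.
    rewrite insubT // !inE; by apply: contra_neqT nv; rewrite negbK -se => /eqP->.
  apply: eq_big => [e|e _]; last by rewrite valK tens_amul laurent_mulX.
  by rewrite valK eqxx andbT !inE -[in RHS](inj_eq val_inj).
Qed.

Definition f_hom : {alghom leavitt k Q -> leavitt k Q'' ⊗ laurent k} :=
  leavitt_lift f_relations.

Lemma f_homE g : f_hom (lgen g) = f_gen g.
Proof. exact: leavitt_liftE. Qed.

End SubgraphMaps.

Section Gradings.
Variable k : fieldType.

(* The degree-n part A (x) k u^n of the grading by the right tensor factor. *)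
Definition laurent_homog (A : lmodType k) (n : int)
    (y : (A ⊗ laurent k)%type) : Prop :=
  exists s : seq (A * k),
    y = \sum_(p <- s) p.1 ⊗ (p.2 *: laurentX k n).

Definition pullback_homog (A B C : assocAlgType k) (g : {alghom A -> C})
    (h : {alghom B -> C}) (gradA : int -> A -> Prop) (gradB : int -> B -> Prop)
    (n : int) (x : pullback g h) : Prop :=
  gradA n (val x).1 /\ gradB n (val x).2.

Definition graded_map (A B : Type) (gradA : int -> A -> Prop)
    (gradB : int -> B -> Prop) (g : A -> B) : Prop :=
  forall n a, gradA n a -> gradB n (g a).

Definition graded_iso (A B : assocAlgType k) (gradA : int -> A -> Prop)
    (gradB : int -> B -> Prop) (g : {alghom A -> B}) : Prop :=
  bijective g /\ forall n a, gradA n a <-> gradB n (g a).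

End Gradings.

(* Main.v *)
Require Import Defs.
From HB Require Import structures.
From mathcomp Require Import all_boot all_order all_algebra.
From mathcomp Require Import boolp functions.

Set Implicit Arguments.
Unset Strict Implicit.
Unset Printing Implicit Defensive.

Import GRing.Theory Num.Theory.
Local Open Scope ring_scope.

(* Both ker pi1 and ker pi2 are generated by v0. Since v0 is a sink of Q'', f maps
   the elements a x0^n b^* of L(Q), with a and b paths that end at v0 and avoid
   x0, to multiples by powers of u of the matrix units a b^* of L(Q''), and so it
   restricts to a bijection from ker pi1 onto ker pi2 (x) k[u, u^-1]; the pullback
   property follows as pi1 is surjective. Injectivity is checked on the corner
   v0 ker(pi1) v0, which is spanned by the x0^n, and uses that v0 is nonzero in
   L(Q''), as seen from the action of L(Q'') on functions on the paths ending at v0.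
   Surjectivity holds because the y such that all y (x) u^n lift to ker pi1 form an
   ideal of L(Q'') that contains v0. *)

(** * Laurent polynomials *)

Section LaurentLift.
Variables (k : fieldType).
Implicit Types (p : {poly k}) (m n : nat) (x y : laurent k).

Local Notation "p %:F" := (@FracField.tofrac {poly k} p).

Lemma laurent_fracP x : exists pm : {poly k} * nat,
  laurent_val x = pm.1%:F / 'X%:F ^+ pm.2.
Proof. by case: (asboolP _ (valP x)) => p [m ->]; exists (p, m). Qed.

Lemma polyX_fracX_neq0 m : 'X%:F ^+ m != 0 :> {fraction {poly k}}.
Proof. by rewrite expf_neq0 // polyX_frac_neq0. Qed.

Variables (V : lmodType k) (w : int -> V).

(** The image of the Laurent polynomial $p/X^m$ under the linear map sending $u^i$ to [w i],
    computed from one numerator and exponent. *)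
Definition laurent_sum p m : V := \sum_(i < size p) p`_i *: w (i%:Z - m%:Z).

Lemma laurent_sum_widen p m n : (size p <= n)%N ->
  laurent_sum p m = \sum_(i < n) p`_i *: w (i%:Z - m%:Z).
Proof.
move=> pn; rewrite /laurent_sum.
rewrite (big_ord_widen n (fun i => p`_i *: w (i%:Z - m%:Z))) // big_mkcond /=.
apply: eq_bigr => i _; case: ltnP => // pi.
by rewrite nth_default ?scale0r.
Qed.

Lemma laurent_sumP c p q m :
  laurent_sum (c *: p + q) m = c *: laurent_sum p m + laurent_sum q m.
Proof.
pose n := maxn (size (c *: p + q)) (maxn (size p) (size q)).
rewrite !(@laurent_sum_widen _ _ n) ?leq_max ?leqnn ?orbT //.
rewrite scaler_sumr -big_split; apply: eq_bigr => i _ /=.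
by rewrite coefD coefZ scalerDl scalerA.
Qed.

(** Numerator and denominator are both multiplied by $X^n$, so the fraction does not change; this
    makes the value independent of the representation. *)
Lemma laurent_sum_shift p m n : laurent_sum (p * 'X^n) (m + n) = laurent_sum p m.
Proof.
rewrite (@laurent_sum_widen _ _ (n + size p)) ?(leq_trans (size_polyMleq _ _)) //;
  last by rewrite size_polyXn addnS /= addnC.
rewrite big_split_ord /= big1 ?add0r => [|i _]; last first.
  by rewrite coefMXn ltn_ord scale0r.
apply: eq_bigr => i _; rewrite coefMXn ltnNge leq_addr /= addKn.
congr (_ *: w _); rewrite !PoszD addrC (addrC n%:Z) opprD addrACA.
by rewrite addNr addr0 addrC.
Qed.

(** The powers $u^i$ form a basis, so any family [w] extends linearly. The representation of [x] is
    picked by choice, and [laurent_lift_frac] shows that it does not matter. *)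
Definition laurent_lift x : V :=
  let pm := projT1 (cid (laurent_fracP x)) in laurent_sum pm.1 pm.2.

Lemma laurent_lift_frac x p m :
  laurent_val x = p%:F / 'X%:F ^+ m -> laurent_lift x = laurent_sum p m.
Proof.
rewrite /laurent_lift; case: cid => -[q n] /= -> /eqP.
rewrite eqr_div ?polyX_fracX_neq0 // -!tofracXn -!tofracM tofrac_eq => /eqP E.
(* Both sums pass to the common denominator $X^{m+n}$, where the numerators agree by
   cross-multiplication. *)
by rewrite -(laurent_sum_shift q n m) E addnC laurent_sum_shift.
Qed.

Lemma laurent_lift_linear : linear laurent_lift.
Proof.
move=> c x y; have [[p m] /= xE] := laurent_fracP x.
have [[q n] /= yE] := laurent_fracP y.
rewrite (@laurent_lift_frac _ (c *: (p * 'X^n) + q * 'X^m) (m + n)).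
  rewrite laurent_sumP laurent_sum_shift addnC laurent_sum_shift.
  by rewrite -(laurent_lift_frac xE) -(laurent_lift_frac yE).
rewrite /= xE yE -mul_polyC tofracD !tofracM !tofracXn exprD [RHS]/=.
rewrite [X in _ = (X + _) / _]mulrA -addf_div ?polyX_fracX_neq0 //.
by rewrite -[in RHS]mulrA.
Qed.

HB.instance Definition _ :=
  GRing.isLinear.Build k (laurent k) V *:%R laurent_lift laurent_lift_linear.

Lemma laurent_liftX (i : int) : laurent_lift (laurentX k i) = w i.
Proof.
case: i => n.
  rewrite (@laurent_lift_frac _ 'X^n 0) /laurent_sum; last first.
    by rewrite /= expr0 divr1 -exprnP tofracXn.
  rewrite size_polyXn big_ord_recr /= big1 ?add0r => [|i _].
    by rewrite coefXn eqxx scale1r subr0.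
  by rewrite coefXn ltn_eqF ?scale0r.
rewrite (@laurent_lift_frac _ 1 n.+1) /laurent_sum; last first.
  by rewrite /= tofrac1 div1r NegzE exprnN.
by rewrite size_poly1 big_ord1 coef1 scale1r sub0r NegzE.
Qed.

End LaurentLift.

Section LaurentInd.
Variable k : fieldType.

Local Notation "p %:F" := (@FracField.tofrac {poly k} p).

(** Extending the family of the $u^i$ linearly reproduces [x], so these powers span; [laurent_ind]
    rests on this. *)
Lemma laurent_lift_id (x : laurent k) : laurent_lift (laurentX k) x = x.
Proof.
have [[p m] /= xE] := laurent_fracP x; apply/val_inj.
rewrite (laurent_lift_frac _ xE) [RHS]xE /laurent_sum [LHS]rmorph_sum /=.
rewrite -[in RHS](coefK p) poly_def raddf_sum mulr_suml; apply: eq_bigr => i _.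
rewrite -mul_polyC /= tofracM tofracXn -mulrA expfzDr ?polyX_frac_neq0 //.
by rewrite exprnN exprnP.
Qed.

Lemma laurent_ind (P : laurent k -> Prop) :
    (forall i, P (laurentX k i)) -> P 0 -> (forall x y, P x -> P y -> P (x + y)) ->
    (forall c x, P x -> P (c *: x)) ->
  forall x, P x.
Proof.
move=> PX P0 PD PZ x; rewrite -(laurent_lift_id x) /laurent_lift /laurent_sum.
by apply: (big_ind P) => // i _; apply/PZ/PX.
Qed.

End LaurentInd.

(** * Coefficients in the tensor product with Laurent polynomials *)

Section LaurentCoefficient.
Variables (k : fieldType) (A : lmodType k).

Definition laurent_coef (n : int) : laurent k -> k^o :=
  laurent_lift (fun m => (m == n)%:R).

HB.instance Definition _ n := GRing.Linear.on (laurent_coef n).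

Lemma laurent_coefX m n : laurent_coef n (laurentX k m) = (m == n)%:R.
Proof. exact: laurent_liftX. Qed.

Lemma laurent_coef_bilin n :
  is_bilinear_map (fun (a : A) l => laurent_coef n l *: a).
Proof.
split=> [a a' l|a l l'|c a l|c a l].
- by rewrite scalerDr.
- by rewrite linearD scalerDl.
- by rewrite !scalerA mulrC.
- by rewrite linearZ /= scalerA.
Qed.

(** The coefficient of $u^n$ in the decomposition $A\otimes k[u,u^{-1}]=\bigoplus_n A\otimes
    ku^n$. *)
Definition tens_coef (n : int) : (A ⊗ laurent k)%type -> A :=
  tens_lift (fun a l => laurent_coef n l *: a).

HB.instance Definition _ n := GRing.isLinear.Build k (A ⊗ laurent k)%type A *:%R
  (tens_coef n) (tens_lift_linear (laurent_coef_bilin n)).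

Lemma tens_coefE n a l : tens_coef n (a ⊗ l) = laurent_coef n l *: a.
Proof. exact: tens_liftE (laurent_coef_bilin n) _ _. Qed.

Lemma tens_coefX n m a : tens_coef n (a ⊗ laurentX k m) = (m == n)%:R *: a.
Proof. by rewrite tens_coefE laurent_coefX. Qed.

Lemma tens_laurent_ind (P : (A ⊗ laurent k)%type -> Prop) :
    (forall a n, P (a ⊗ laurentX k n)) -> P 0 ->
    (forall x y, P x -> P y -> P (x + y)) ->
  forall x, P x.
Proof.
move=> PX P0 PD.
(* Treating all scalar multiples at once makes the scaling case of [tens_ind] immediate; on pure
   tensors the scalar is absorbed by a factor. *)
pose R x := forall c : k, P (c *: x).
suff H x : R x by move=> x; rewrite -[x]scale1r; apply: H.
elim/tens_ind: x => [a l||x y Px Py|c x Px] d.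
- rewrite -tensZr; elim/laurent_ind: (d *: l) (a) => [i||x y Px Py|c x Px] b //.
  + by rewrite tens0r.
  + by rewrite tensDr; apply: PD.
  + by rewrite tensZr -tensZl.
- by rewrite scaler0.
- by rewrite scalerDr; apply: PD.
- by rewrite scalerA.
Qed.

Lemma tens_coef_sum (y : (A ⊗ laurent k)%type) :
  exists s : seq int, y = \sum_(n <- s) tens_coef n y ⊗ laurentX k n.
Proof.
(* The expansion is proved over every duplicate-free list containing a support [s], so that those of
   two summands can be compared over one list. *)
suff [s sP] : exists s : seq int, forall t, uniq t -> {subset s <= t} ->
    y = \sum_(n <- t) tens_coef n y ⊗ laurentX k n.
  by exists (undup s); apply: sP; rewrite ?undup_uniq // => n; rewrite mem_undup.
elim/tens_laurent_ind: y => [a n||x y [s sP] [s' s'P]].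
- exists [:: n] => t t_uniq st; rewrite (bigD1_seq n) ?st ?mem_head //=.
  rewrite tens_coefX eqxx scale1r big1 ?addr0 // => m /negPf mn.
  by rewrite tens_coefX eq_sym mn scale0r tens0l.
- by exists [::] => t _ _; rewrite big1 // => n _; rewrite linear0 tens0l.
- exists (s ++ s') => t t_uniq st.
  rewrite {1}(sP t) // => [|n ns]; last by rewrite st // mem_cat ns.
  rewrite {1}(s'P t) // => [|n ns]; last by rewrite st // mem_cat ns orbT.
  by rewrite -big_split; apply: eq_bigr => n _; rewrite linearD tensDl.
Qed.

(** Each coefficient of $a\otimes l$ is the corresponding coefficient of $l$ times $a$, and $a\neq
    0$. *)
Lemma tens_coef_eq0 (a : A) (l : laurent k) : a != 0 -> a ⊗ l = 0 -> l = 0.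
Proof.
move=> a0 al0; rewrite -[l]laurent_lift_id /laurent_lift.
case: cid => -[p m] /= lE; rewrite /laurent_sum big1 // => i _.
suff -> : p`_i = 0 by rewrite scale0r.
have /eqP : tens_coef (i%:Z - m%:Z) (a ⊗ l) = 0 by rewrite al0 linear0.
rewrite tens_coefE scaler_eq0 (negPf a0) orbF /laurent_coef.
rewrite (laurent_lift_frac _ lE) /laurent_sum (bigD1 i) //= eqxx.
rewrite big1 ?addr0 => [/eqP|j /negPf ji]; first by rewrite /*:%R /= mulr1.
by rewrite (inj_eq (addIr _)) eqz_nat val_eqE ji scaler0.
Qed.

End LaurentCoefficient.

Lemma tens_coef_hom (k : fieldType) (A B : assocAlgType k) (g : {alghom A -> B})
    n (y : (A ⊗ laurent k)%type) :
  tens_coef n (tens_hom g idfun y) = g (tens_coef n y).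
Proof.
elim/tens_laurent_ind: y => [a m||x y Hx Hy].
- by rewrite tens_homE !tens_coefX linearZ.
- by rewrite !linear0.
- by rewrite !linearD /= Hx Hy.
Qed.

(** * Ideals and kernels *)

Section Ideal.
Variables (k : fieldType) (A : assocAlgType k).

(** As the algebras may lack a unit, closure under scalars is a condition of its own. *)
Record is_ideal (I : A -> Prop) : Prop := IsIdeal {
  ideal0 : I 0;
  idealD : forall x y, I x -> I y -> I (x + y);
  idealZ : forall c x, I x -> I (c *: x);
  idealMl : forall a x, I x -> I (a ** x);
  idealMr : forall a x, I x -> I (x ** a) }.

Lemma ideal_ker (B : assocAlgType k) (g : {alghom A -> B}) :
  is_ideal (fun x => g x = 0).
Proof.
split=> [|x y gx gy|c x gx|a x gx|a x gx].
- exact: linear0.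
- by rewrite linearD /= gx gy addr0.
- by rewrite linearZ /= gx scaler0.
- by rewrite amorphM /= gx amul0r.
- by rewrite amorphM /= gx amul0l.
Qed.

Variables (I : A -> Prop) (idI : is_ideal I).

Lemma idealN x : I x -> I (- x).
Proof. by rewrite -scaleN1r; apply: idealZ. Qed.

Lemma idealB x y : I x -> I y -> I (x - y).
Proof. by move=> Ix Iy; apply: idealD => //; apply: idealN. Qed.

Lemma ideal_sum (J : Type) (r : seq J) (P : pred J) (F : J -> A) :
  (forall i, P i -> I (F i)) -> I (\sum_(i <- r | P i) F i).
Proof. by move=> IF; apply: (big_ind I) => //; [apply: ideal0|apply: idealD]. Qed.

Definition eqmod x y := I (x - y).

Lemma eqmod_refl x : eqmod x x.
Proof. by rewrite /eqmod subrr; apply: ideal0. Qed.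

Lemma eqmod_sym x y : eqmod x y -> eqmod y x.
Proof. by rewrite /eqmod => /idealN; rewrite opprB. Qed.

Lemma eqmod_trans y x z : eqmod x y -> eqmod y z -> eqmod x z.
Proof. by rewrite /eqmod => xy /(idealD idI xy); rewrite addrA subrK. Qed.

Lemma eqmodD x x' y y' : eqmod x x' -> eqmod y y' -> eqmod (x + y) (x' + y').
Proof. by rewrite /eqmod opprD addrACA; apply: idealD. Qed.

Lemma eqmodZ c x x' : eqmod x x' -> eqmod (c *: x) (c *: x').
Proof. by rewrite /eqmod -scalerBr; apply: idealZ. Qed.

Lemma amulBr (x y z : A) : x ** (y - z) = x ** y - x ** z.
Proof. by rewrite amulDr -[- z]scaleN1r -ascalerAr scaleN1r. Qed.

Lemma amulBl (x y z : A) : (y - z) ** x = y ** x - z ** x.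
Proof. by rewrite amulDl -[- z]scaleN1r -ascalerAl scaleN1r. Qed.

Lemma eqmodM x x' y y' : eqmod x x' -> eqmod y y' -> eqmod (x ** y) (x' ** y').
Proof.
move=> xx yy; apply: (@eqmod_trans (x ** y')); rewrite /eqmod.
  by rewrite -amulBr; apply: idealMl.
by rewrite -amulBl; apply: idealMr.
Qed.

End Ideal.

Section LeavittIdeal.
Variables (k : fieldType) (Q : graph).

Lemma leavitt_ideal (I : leavitt k Q -> Prop) :
    I 0 -> (forall x y, I x -> I y -> I (x + y)) ->
    (forall c x, I x -> I (c *: x)) ->
    (forall g x, I x -> I (lgen g ** x)) ->
    (forall g x, I x -> I (x ** lgen g)) ->
  is_ideal I.
Proof.
move=> I0 ID IZ Il Ir; split=> //.
- move=> a; elim/leavitt_ind: a => [g||x y Hx Hy|c x Hx|x y Hx Hy] z Iz.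
  + exact: Il.
  + by rewrite amul0l.
  + by rewrite amulDl; apply: ID; auto.
  + by rewrite -ascalerAl; apply: IZ; auto.
  + by rewrite -amulA; auto.
- move=> a; elim/leavitt_ind: a => [g||x y Hx Hy|c x Hx|x y Hx Hy] z Iz.
  + exact: Ir.
  + by rewrite amul0r.
  + by rewrite amulDr; apply: ID; auto.
  + by rewrite -ascalerAr; apply: IZ; auto.
  + by rewrite amulA; auto.
Qed.

Variables (A : assocAlgType k) (I : A -> Prop) (g : generator Q -> A).
Hypothesis idI : is_ideal I.

Local Notation "x ≡ y" := (eqmod I x y) (at level 70).

(** The relations (L1) to (L5) in $A/I$, written as congruences so that no quotient algebra has to
    be formed. *)
Definition leavitt_relations_mod : Prop :=
  [/\ forall v w, g (GVertex v) ** g (GVertex w)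
                  ≡ if v == w then g (GVertex v) else 0,
      forall e, g (GVertex (source e)) ** g (GEdge e) ≡ g (GEdge e)
             /\ g (GEdge e) ** g (GVertex (target e)) ≡ g (GEdge e),
      forall e, g (GVertex (target e)) ** g (GGhost e) ≡ g (GGhost e)
             /\ g (GGhost e) ** g (GVertex (source e)) ≡ g (GGhost e),
      forall e f, g (GGhost e) ** g (GEdge f)
                  ≡ if e == f then g (GVertex (target e)) else 0
    & forall v, out_edges v != set0 ->
        \sum_(e in out_edges v) g (GEdge e) ** g (GGhost e) ≡ g (GVertex v)].

Hypothesis g_rel : leavitt_relations_mod.

Lemma leval_eqmod s t : lcong s t -> leval g s ≡ leval g t.
Proof.
case: g_rel => r1 r2 r3 r4 r5.
have eqI x y : x = y -> x ≡ y by move=> ->; apply: eqmod_refl.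
elim=> {s t} /=.
- by move=> s; apply: eqI.
- by move=> s t _; apply: eqmod_sym.
- by move=> s t r _ st _; apply: eqmod_trans st.
- by move=> s s' _ /(eqmodZ idI (-1)); rewrite !scaleN1r.
- by move=> s s' t t' _ ss _; apply: eqmodD.
- by move=> c s s' _; apply: eqmodZ.
- by move=> s s' t t' _ ss _; apply: eqmodM.
- by move=> s t r; apply: eqI; rewrite addrA.
- by move=> s t; apply: eqI; rewrite addrC.
- by move=> s; apply: eqI; rewrite add0r.
- by move=> s; apply: eqI; rewrite addNr.
- by move=> c d s; apply: eqI; rewrite scalerA.
- by move=> s; apply: eqI; rewrite scale1r.
- by move=> c s t; apply: eqI; rewrite scalerDr.
- by move=> s c d; apply: eqI; rewrite scalerDl.
- by move=> s t r; apply: eqI; rewrite amulA.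
- by move=> s t r; apply: eqI; rewrite amulDl.
- by move=> s t r; apply: eqI; rewrite amulDr.
- by move=> c s t; apply: eqI; rewrite ascalerAl.
- by move=> c s t; apply: eqI; rewrite ascalerAr.
- by move=> v w; have := r1 v w; case: ifP.
- by move=> e; case: (r2 e).
- by move=> e; case: (r2 e).
- by move=> e; case: (r3 e).
- by move=> e; case: (r3 e).
- by move=> e f; have := r4 e f; case: ifP.
- move=> v /r5; congr (_ ≡ _).
  by elim/big_rec2: _ => //= e x y _ ->.
Qed.

End LeavittIdeal.

(* A homomorphism L(P) -> L(S) that inverts an embedding j of generators modulo
   the ideal I has its kernel in I: composing it with any set-theoretic section
   of the projection from formal expressions gives the identity modulo I. *)
Section KernelInIdeal.
Variables (k : fieldType) (P S : graph).
Variables (jv : vertex S -> vertex P) (je : edge S -> edge P).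
Hypotheses (jv_inj : injective jv) (je_inj : injective je).
Hypothesis source_je : forall e, source (je e) = jv (source e).
Hypothesis target_je : forall e, target (je e) = jv (target e).

Definition embed_gen (g : generator S) : generator P :=
  match g with
  | GVertex v => GVertex (jv v)
  | GEdge e => GEdge (je e)
  | GGhost e => GGhost (je e)
  end.

Variables (h : {alghom leavitt k P -> leavitt k S}) (I : leavitt k P -> Prop).
Hypothesis idI : is_ideal I.
Hypothesis noenter : forall e, e \notin codom je -> I (lgen (GVertex (target e))).
Hypothesis hI : forall g,
  (exists2 g', h (lgen g) = lgen g' & g = embed_gen g')
  \/ (h (lgen g) = 0 /\ I (lgen g)).

(** (L1) to (L4) hold exactly. In (L5) the sum taken in [P] also runs over edges outside the image
    of [je], which contribute only elements of [I]. *)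
Lemma embed_relations_mod :
  leavitt_relations_mod I (fun g => lgen (embed_gen g)).
Proof.
case: (leavitt_lgen_relations k P) => r1 r2 r3 r4 r5.
have eqI x y : x = y -> eqmod I x y by move=> ->; apply: eqmod_refl.
split=> /= [v w|e|e|e f|v].
- by apply: eqI; rewrite r1 (inj_eq jv_inj).
- by case: (r2 (je e)); rewrite source_je target_je => -> ->; split; apply: eqI.
- by case: (r3 (je e)); rewrite source_je target_je => -> ->; split; apply: eqI.
- by apply: eqI; rewrite r4 (inj_eq je_inj) target_je.
- case/set0Pn=> e; rewrite !inE => /eqP se.
  rewrite -r5; last first.
    by apply/set0Pn; exists (je e); rewrite !inE source_je se.
  apply: eqmod_sym => //; rewrite (bigID (mem (codom je))) /=.
  (* An edge $x$ outside the image equals $x\,t(x)$, and $t(x)\in I$ by [noenter]. *)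
  set T := (X in _ + X); have IT : I T.
    apply: ideal_sum => // f /andP[_ fN]; case: (r2 f) => _ <-.
    by apply: idealMr => //; apply: idealMl => //; apply: noenter.
  rewrite /eqmod; set U := (X in X + T - _); set W := (X in _ - X).
  suff -> : U = W by rewrite addrAC subrr add0r.
  rewrite /U /W.
  rewrite (reindex_omap je (fun f => [pick f' | je f' == f])) /=; last first.
    move=> f /andP[_ /codomP[f' ->]]; case: pickP => [f'' /eqP /= -> //|/(_ f')].
    by rewrite eqxx.
  apply: eq_bigl => f; rewrite codom_f !inE andbT source_je (inj_eq jv_inj).
  case: pickP => [f' /eqP /je_inj ->|/(_ f)]; last by rewrite eqxx.
  by rewrite eqxx andbT.
Qed.

Lemma ker_in_ideal x : h x = 0 -> I x.
Proof.
pose sec (y : leavitt k S) : leavitt k P :=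
  leval (fun g => lgen (embed_gen g)) (repr y).
have cong := leval_eqmod idI embed_relations_mod.
have secE s : eqmod I (sec (lclass s)) (leval (fun g => lgen (embed_gen g)) s).
  exact/cong/lcong_repr.
have trans := eqmod_trans idI.
have sec0 : I (sec 0) by have := secE (LZero _ _); rewrite /eqmod subr0.
(* Although [sec] depends on representatives, modulo [I] it respects sums, scalars and products, so
   comparing on generators suffices. *)
have sec_id z : eqmod I (sec (h z)) z.
  elim/leavitt_ind: z => [g||z w Hz Hw|c z Hz|z w Hz Hw].
  - case: (hI g) => [[g' -> ->]|[-> Ig]]; first exact: secE.
    exact: idealB.
  - by rewrite linear0 /eqmod subr0.
  - rewrite linearD /= -[h z]lclass_repr -[h w]lclass_repr.
    rewrite -[lclass _ + _]lclass_add.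
    by apply: trans (secE _) _; apply: eqmodD.
  - rewrite linearZ /= -[h z]lclass_repr -[_ *: _]lclass_scale.
    by apply: trans (secE _) _; apply: eqmodZ.
  - rewrite amorphM /= -[h z]lclass_repr -[h w]lclass_repr.
    rewrite -[lclass _ ** _]lclass_mul.
    by apply: trans (secE _) _; apply: eqmodM.
move=> hx; have := sec_id x; rewrite hx /eqmod => /(idealB idI sec0).
by rewrite opprB addrC subrK.
Qed.

End KernelInIdeal.

(** * The vertex projection of a sink is nonzero *)

Section Endomorphisms.
Variables (k : fieldType) (V : lmodType k).

(** Linear endomorphisms are cut out of the space of all maps [V -> V], whose module structure they
    inherit; with composition they form the target algebra of a representation. *)
Definition lend_pred : {pred V -> V} := fun f => `[< linear f >].

Record lend := LEnd { lend_val : V -> V; _ : lend_val \in lend_pred }.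

HB.instance Definition _ := [isSub for lend_val].
HB.instance Definition _ := [Choice of lend by <:].

Lemma lend_submod : subsemimod_closed lend_pred.
Proof.
split; first split.
- by apply/asboolP => c x y; rewrite scaler0 addr0.
- move=> f g /asboolP fl /asboolP gl; apply/asboolP => c x y.
  rewrite -[(f + g) _]/(f _ + g _) fl gl.
  by rewrite addrACA -scalerDr.
- move=> d f /asboolP fl; apply/asboolP => c x y.
  rewrite -[(d *: f) _]/(d *: f _) fl scalerDr !scalerA.
  by rewrite mulrC -scalerA.
Qed.

HB.instance Definition _ :=
  GRing.SubChoice_isSubLmodule.Build k (V -> V) lend_pred lend lend_submod.

Lemma lendP (f : lend) : linear (val f).
Proof. exact/asboolP/(valP f). Qed.

Fact lend_comp_subproof (f g : lend) : val f \o val g \in lend_pred.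
Proof. by apply/asboolP => c x y; rewrite /= !lendP. Qed.

Definition lend_comp (f g : lend) : lend := LEnd (lend_comp_subproof f g).

Lemma lend_compA : associative lend_comp.
Proof. by move=> f g h; apply/val_inj. Qed.
Lemma lend_compDl : left_distributive lend_comp +%R.
Proof. by move=> f g h; apply/val_inj. Qed.
Lemma lend_compDr : right_distributive lend_comp +%R.
Proof.
move=> f g h; apply/val_inj/funext => x /=.
by have := lendP f 1 (val g x) (val h x); rewrite !scale1r.
Qed.
Lemma lend_scaleAl (c : k) f g : c *: lend_comp f g = lend_comp (c *: f) g.
Proof. exact/val_inj. Qed.
Lemma lend_scaleAr (c : k) f g : c *: lend_comp f g = lend_comp f (c *: g).
Proof.
apply/val_inj/funext => x /=.
have f0 : val f 0 = 0.
  by have := lendP f (-1) 0 0; rewrite scaler0 addr0 scaleN1r addNr.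
by have := lendP f c (val g x) 0; rewrite f0 !addr0 => /esym.
Qed.

HB.instance Definition _ := Lmodule_isAssocAlgebra.Build k lend
  lend_compA lend_compDl lend_compDr lend_scaleAl lend_scaleAr.

End Endomorphisms.

(* L(Q) acts on the functions on the paths ending at a sink w: edges act by
   prepending, ghost edges by removing the first edge; (L5) only concerns vertices
   other than w, and the paths starting at those are nontrivial. *)
Section SinkRepresentation.
Variables (k : fieldType) (Q : graph) (w : vertex Q).
Hypothesis sink_w : out_edges w = set0.

(** The empty path sits at [w]; through this default, [is_path] forces the last edge of a nonempty
    path to end at [w]. *)
Definition path_source (p : seq (edge Q)) : vertex Q :=
  if p is e :: _ then source e else w.

Fixpoint is_path (p : seq (edge Q)) : bool :=
  if p is e :: p' then (target e == path_source p') && is_path p' else true.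

Local Notation V := (seq (edge Q) -> k^o).

(** The [is_path] tests make every result vanish off paths, so arbitrary sequences of edges can
    serve as the domain. *)
Definition path_action (g : generator Q) (phi : V) : V :=
  match g with
  | GVertex v => fun p => if (path_source p == v) && is_path p then phi p else 0
  | GEdge e => fun p => if p is e' :: p' then
      if (e == e') && is_path p then phi p' else 0 else 0
  | GGhost e => fun p => if is_path (e :: p) then phi (e :: p) else 0
  end.

Fact path_action_subproof g : path_action g \in @lend_pred k V.
Proof.
apply/asboolP => c phi psi; apply/funext.
case: g => [v|e|e] /= p; rewrite -[RHS]/(c *: _ + _);
  last 1 first.
- by case: ifP => //; rewrite scaler0 addr0.
- by case: ifP => //; rewrite scaler0 addr0.
- by case: p => [|e' p]; last case: ifP => //; rewrite scaler0 addr0.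
Qed.

Definition path_rep (g : generator Q) : lend V := LEnd (path_action_subproof g).

Lemma path_rep_relations : leavitt_relations path_rep.
Proof.
split.
- move=> u v; apply/val_inj/funext => phi; apply/funext => p /=.
  case: (eqVneq u v) => [->|uv] /=; first by case: ifP => // ->.
  by case: andP => // -[/eqP-> _]; rewrite (negPf uv).
- move=> e; split; apply/val_inj/funext => phi; apply/funext => -[|e' p] //=.
  + by rewrite if_same.
  + case: (eqVneq e e') => [<-|] /=; last by rewrite if_same.
    by rewrite eqxx /=; case: ifP => // ->.
  + case: (eqVneq e e') => [<-|] //=.
    by rewrite (eq_sym (path_source _)); case: ifP => // ->.
- move=> e; split; apply/val_inj/funext => phi; apply/funext => p /=.
  + by rewrite eq_sym; case: ifP => // ->.
  + by rewrite eqxx /=; case: ifP => // ->.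
- move=> e f; apply/val_inj/funext => phi; apply/funext => p /=.
  case: (eqVneq e f) => [->|ne] /=; last by rewrite if_same.
  by rewrite [in RHS]eq_sym; case: ifP => // ->.
- move=> v out_v; have wv : w != v by apply: contraNneq out_v => <-; apply/eqP.
  apply/val_inj; rewrite raddf_sum; apply/funext => phi; apply/funext => p.
  rewrite !fct_sumE; case: p => [|e' p] /=.
    by rewrite (negPf wv) big1.
  case: ifP => [/andP[/eqP sv pth]|/negbT npth].
    (* Only the first edge [e'] of the path contributes to the sum. *)
    rewrite (bigD1 e') ?inE ?sv //= eqxx pth big1 ?addr0 // => e /andP[_ /negPf ne].
    by rewrite ne.
  rewrite big1 // => e; rewrite !inE => /eqP se.
  case: ifP => // /andP[/eqP ee pth]; case/negP: npth.
  by rewrite -[in source _]ee se eqxx.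
Qed.

Lemma sink_neq0 : lgen (GVertex w) != 0 :> leavitt k Q.
Proof.
apply/eqP => w0; have := leavitt_liftE path_rep_relations (GVertex w).
(* The vertex [w] sends the constant function 1 to a function with value 1 at the empty path. *)
rewrite w0 linear0 => /(congr1 val) /(congr1 (fun h => h (fun=> 1) [::])) /=.
by rewrite eqxx => /eqP; rewrite eq_sym oner_eq0.
Qed.

End SinkRepresentation.

(** * Gradings *)

Section LaurentHomog.
Variable k : fieldType.

(** Scalars move to the left factor, and tensors with a common right factor add up to a single
    tensor. *)
Lemma laurent_homogP (A : lmodType k) n (y : (A ⊗ laurent k)%type) :
  laurent_homog n y <-> exists a, y = a ⊗ laurentX k n.
Proof.
split=> [[s ->]|[a ->]].
  exists (\sum_(p <- s) p.2 *: p.1); rewrite -tens_sum.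
  by apply: eq_bigr => p _; rewrite tensZr tensZl.
by exists [:: (a, 1)]; rewrite big_seq1 scale1r.
Qed.

Lemma laurent_homog_tens (A : lmodType k) n (a : A) :
  laurent_homog n (a ⊗ laurentX k n).
Proof. by apply/laurent_homogP; exists a. Qed.

Lemma tens_hom_homog (A B : assocAlgType k) (g : {alghom A -> B}) :
  graded_map (@laurent_homog k A) (@laurent_homog k B) (tens_hom g idfun).
Proof.
move=> n _ /laurent_homogP[a ->]; rewrite tens_homE; exact: laurent_homog_tens.
Qed.

Lemma alghom_homog (Q : graph) (A : assocAlgType k) (grad : int -> A -> Prop)
    (h : {alghom leavitt k Q -> A}) :
    (forall n, grad n 0) ->
    (forall n x y, grad n x -> grad n y -> grad n (x + y)) ->
    (forall n c x, grad n x -> grad n (c *: x)) ->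
    (forall m n x y, grad m x -> grad n y -> grad (m + n) (x ** y)) ->
    (forall g, grad (gdegree g) (h (lgen g))) ->
  graded_map (@leavitt_homog k Q) grad h.
Proof.
move=> h0 hD hZ hM hg n x.
elim=> {n x} [g|n|n x y _ Hx _ Hy|n c x _ Hx|m n x y _ Hx _ Hy].
- exact: hg.
- by rewrite linear0.
- by rewrite linearD; apply: hD.
- by rewrite linearZ; apply: hZ.
- by rewrite amorphM; apply: hM.
Qed.

Lemma alghom_laurent_homog (Q : graph) (A : assocAlgType k)
    (h : {alghom leavitt k Q -> A ⊗ laurent k}) :
    (forall g, laurent_homog (gdegree g) (h (lgen g))) ->
  graded_map (@leavitt_homog k Q) (@laurent_homog k A) h.
Proof.
apply: alghom_homog => [n|n _ _ /laurent_homogP[a ->] /laurent_homogP[b ->]||].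
- by rewrite -(tens0l A (laurentX k n)); apply: laurent_homog_tens.
- by rewrite -tensDl; apply: laurent_homog_tens.
- by move=> n c _ /laurent_homogP[a ->]; rewrite -tensZl; apply: laurent_homog_tens.
- move=> m n _ _ /laurent_homogP[a ->] /laurent_homogP[b ->].
  by rewrite tens_amul laurent_mulX; apply: laurent_homog_tens.
Qed.

End LaurentHomog.

(** * Homogeneous components read off from the coaction *)

Section HomogeneousComponents.
Variables (k : fieldType) (Q : graph).

(** True on generators, and exponents add up under products as degrees do. Since [delta] records the
    degree as the exponent of $u$, [leavitt_comp] can use it to extract homogeneous components. *)
Lemma delta_homog n (x : leavitt k Q) :
  leavitt_homog n x -> delta k Q x = x ⊗ laurentX k n.
Proof.
elim=> {n x} [g|n|n x y _ Hx _ Hy|n c x _ Hx|m n x y _ Hx _ Hy].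
- by rewrite deltaE; case: g => [v|e|e] //=; rewrite laurentX0.
- by rewrite linear0 tens0l.
- by rewrite linearD /= Hx Hy tensDl.
- by rewrite linearZ /= Hx tensZl.
- by rewrite amorphM /= Hx Hy tens_amul laurent_mulX.
Qed.

Lemma delta_graded :
  graded_map (@leavitt_homog k Q) (@laurent_homog k _) (delta k Q).
Proof. by move=> n x /delta_homog->; apply: laurent_homog_tens. Qed.

Lemma leavitt_homog_ind (P : leavitt k Q -> Prop) :
    (forall n x, leavitt_homog n x -> P x) ->
    (forall x y, P x -> P y -> P (x + y)) ->
  forall x, P x.
Proof.
move=> Ph PD.
(* [R x] says that [x] is a finite sum of homogeneous elements; quantifying over all predicates
   allows it to be applied below to $z\mapsto R(cz)$ and $z\mapsto R(zy)$. *)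
pose R x := forall P : leavitt k Q -> Prop,
  (forall n x, leavitt_homog n x -> P x) ->
  (forall x y, P x -> P y -> P (x + y)) -> P x.
have Rh n x : leavitt_homog n x -> R x by move=> hx S Sh _; apply: Sh hx.
have RD x y : R x -> R y -> R (x + y).
  by move=> Rx Ry S Sh SD; apply: (SD); [apply: Rx|apply: Ry].
suff H x : R x by move=> x; apply: H.
elim/leavitt_ind: x => [g||//|c x Rx|x y Rx Ry].
- exact: Rh (lhomog_gen _ g).
- exact: Rh (lhomog0 _ _ 0).
- apply: (Rx (fun z => R (c *: z))) => [n z hz|z t Rz Rt].
    exact: Rh (lhomogZ c hz).
  by rewrite scalerDr; apply: RD.
- apply: (Rx (fun z => R (z ** y))) => [n z hz|z t Rz Rt].
    apply: (Ry (fun t => R (z ** t))) => [m t ht|t t' Rt Rt'].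
      exact: Rh (lhomogM hz ht).
    by rewrite amulDr; apply: RD.
  by rewrite amulDl; apply: RD.
Qed.

Definition leavitt_comp n (x : leavitt k Q) := tens_coef n (delta k Q x).

Lemma leavitt_comp_homog n x : leavitt_homog n (leavitt_comp n x).
Proof.
elim/leavitt_homog_ind: x => [m x hx|x y Hx Hy].
  rewrite /leavitt_comp (delta_homog hx) tens_coefX.
  case: eqP => [<-|_]; first by rewrite scale1r.
  by rewrite scale0r; apply: lhomog0.
by rewrite /leavitt_comp !linearD; apply: lhomogD.
Qed.

End HomogeneousComponents.

Lemma leavitt_comp_hom (k : fieldType) (Q S : graph)
    (h : {alghom leavitt k Q -> leavitt k S}) n x :
  graded_map (@leavitt_homog k Q) (@leavitt_homog k S) h ->
  h (leavitt_comp n x) = tens_coef n (delta k S (h x)).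
Proof.
move=> hh; elim/leavitt_homog_ind: x => [m x hx|x y Hx Hy].
  rewrite /leavitt_comp (delta_homog hx) (delta_homog (hh _ _ hx)) !tens_coefX.
  by rewrite linearZ.
by rewrite /leavitt_comp !linearD /= -Hx -Hy.
Qed.

Lemma leavitt_comp_laurent (k : fieldType) (Q : graph) (A : assocAlgType k)
    (h : {alghom leavitt k Q -> A ⊗ laurent k}) n x :
  graded_map (@leavitt_homog k Q) (@laurent_homog k A) h ->
  h (leavitt_comp n x) = tens_coef n (h x) ⊗ laurentX k n.
Proof.
move=> hh; elim/leavitt_homog_ind: x => [m x hx|x y Hx Hy].
  rewrite /leavitt_comp (delta_homog hx) tens_coefX linearZ /=.
  case/laurent_homogP: (hh _ _ hx) => a ->; rewrite tens_coefX tensZl.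
  by case: eqP => [->|_] //; rewrite !scale0r.
by rewrite /leavitt_comp !linearD /= tensDl -Hx -Hy.
Qed.

(** * The ideal generated by a vertex whose only exit is a loop *)

Section LoopVertex.
Variables (k : fieldType) (Q : graph) (v0 : vertex Q) (x0 : edge Q).
Hypotheses (out_v0 : out_edges v0 = [set x0]) (loop_x0 : target x0 = v0).

Local Notation L := (leavitt k Q).
Local Notation Vx v := (lgen (GVertex v) : L).
Local Notation Ed e := (lgen (GEdge e) : L).
Local Notation Gh e := (lgen (GGhost e) : L).

Lemma loop_source : source x0 = v0.
Proof. by have := set11 x0; rewrite -out_v0 !inE => /eqP. Qed.

Lemma source_neq_loop e : e != x0 -> (source e == v0) = false.
Proof.
apply: contra_neqF => /eqP se; apply/set1P.
by rewrite -out_v0 !inE se.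
Qed.

Lemma VxM v w : Vx v ** Vx w = if v == w then Vx v else 0.
Proof. by case: (leavitt_lgen_relations k Q). Qed.

Lemma VxEd v e : Vx v ** Ed e = if v == source e then Ed e else 0.
Proof.
case: (leavitt_lgen_relations k Q) => _ r2 _ _ _.
rewrite -{1}(proj1 (r2 e)) amulA VxM.
case: eqP => [->|_]; last by rewrite amul0l.
by case: (r2 e).
Qed.

Lemma EdVx v e : Ed e ** Vx v = if v == target e then Ed e else 0.
Proof.
case: (leavitt_lgen_relations k Q) => _ r2 _ _ _.
rewrite -{1}(proj2 (r2 e)) -amulA VxM eq_sym.
case: eqP => _; last by rewrite amul0r.
by case: (r2 e).
Qed.

Lemma VxGh v e : Vx v ** Gh e = if v == target e then Gh e else 0.
Proof.
case: (leavitt_lgen_relations k Q) => _ _ r3 _ _.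
rewrite -{1}(proj1 (r3 e)) amulA VxM.
case: eqP => [->|_]; last by rewrite amul0l.
by case: (r3 e).
Qed.

Lemma GhVx v e : Gh e ** Vx v = if v == source e then Gh e else 0.
Proof.
case: (leavitt_lgen_relations k Q) => _ _ r3 _ _.
rewrite -{1}(proj2 (r3 e)) -amulA VxM eq_sym.
case: eqP => _; last by rewrite amul0r.
by case: (r3 e).
Qed.

Lemma GhEd e f : Gh e ** Ed f = if e == f then Vx (target e) else 0.
Proof. by case: (leavitt_lgen_relations k Q). Qed.

Lemma Vx_Ed_eq0 e : e != x0 -> Vx v0 ** Ed e = 0.
Proof. by move=> ex; rewrite VxEd eq_sym source_neq_loop. Qed.

Lemma Gh_Vx_eq0 e : e != x0 -> Gh e ** Vx v0 = 0.
Proof. by move=> ex; rewrite GhVx eq_sym source_neq_loop. Qed.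

(** (L5) at $v_0$ has a single term. With [loop_GhEd] this makes $x_0$ invertible in the corner at
    $v_0$, with inverse its ghost. *)
Lemma loop_EdGh : Ed x0 ** Gh x0 = Vx v0.
Proof.
case: (leavitt_lgen_relations k Q) => _ _ _ _ r5; rewrite -r5 ?out_v0 ?big_set1 //.
by apply/set0Pn; exists x0; rewrite inE.
Qed.

Lemma loop_GhEd : Gh x0 ** Ed x0 = Vx v0.
Proof. by rewrite GhEd eqxx loop_x0. Qed.

(** The power $x_0^i$ in the corner at $v_0$: its unit is $v_0$, and [Negz n] stands for $-(n+1)$,
    hence $n+1$ ghost edges. *)
Definition loop_pow (i : int) : L :=
  match i with
  | Posz n => iter n (amul (Ed x0)) (Vx v0)
  | Negz n => iter n.+1 (amul (Gh x0)) (Vx v0)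
  end.

Lemma Vx_loop_pow i : Vx v0 ** loop_pow i = loop_pow i.
Proof.
case: i => [[|n]|n] /=; first by rewrite VxM eqxx.
  by rewrite amulA VxEd loop_source eqxx.
by rewrite amulA VxGh loop_x0 eqxx.
Qed.

Lemma Ed_loop_pow i : Ed x0 ** loop_pow i = loop_pow (i + 1).
Proof.
case: i => n; first by rewrite addrC.
have -> : Negz n + 1 = - n%:Z by rewrite NegzE -addn1 PoszD opprD addrNK.
case: n => [|n] /=; rewrite amulA loop_EdGh ?VxM ?eqxx //.
by rewrite amulA VxGh loop_x0 eqxx.
Qed.

Lemma Gh_loop_pow i : Gh x0 ** loop_pow i = loop_pow (i - 1).
Proof.
by rewrite -{1}(subrK 1 i) -Ed_loop_pow amulA loop_GhEd Vx_loop_pow.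
Qed.

(** Used with $a$ among $v_0$, $x_0$ and its ghost to turn rules for left multiplication into rules
    for right multiplication. *)
Lemma loop_pow_comm a i : a ** Vx v0 = Vx v0 ** a ->
  a ** Ed x0 = Ed x0 ** a -> a ** Gh x0 = Gh x0 ** a ->
  a ** loop_pow i = loop_pow i ** a.
Proof.
move=> aV aE aG; rewrite /loop_pow; case: i => n; last move: (n.+1) => {}n.
  by elim: n => //= n IHn; rewrite amulA aE -amulA IHn amulA.
by elim: n => //= n IHn; rewrite amulA aG -amulA IHn amulA.
Qed.

Lemma loop_pow_Vx i : loop_pow i ** Vx v0 = loop_pow i.
Proof.
rewrite -loop_pow_comm ?Vx_loop_pow // ?VxEd ?EdVx ?VxGh ?GhVx;
  by rewrite loop_x0 loop_source eqxx.
Qed.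

Lemma loop_pow_Ed i : loop_pow i ** Ed x0 = loop_pow (i + 1).
Proof.
rewrite -loop_pow_comm ?Ed_loop_pow ?loop_EdGh ?loop_GhEd // ?VxEd ?EdVx.
by rewrite loop_x0 loop_source eqxx.
Qed.

Lemma loop_pow_Gh i : loop_pow i ** Gh x0 = loop_pow (i - 1).
Proof.
rewrite -loop_pow_comm ?Gh_loop_pow ?loop_EdGh ?loop_GhEd // ?VxGh ?GhVx.
by rewrite loop_x0 loop_source eqxx.
Qed.

Local Notation theta := (laurent_lift loop_pow).

(** Linear extension from powers: $a$ acts on the image of [theta] as multiplication by $u^j$, with
    $j=0,1,-1$ for $v_0$, $x_0$ and its ghost. *)
Lemma theta_amull a j l : (forall i, a ** loop_pow i = loop_pow (i + j)) ->
  a ** theta l = theta (laurentX k j ** l).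
Proof.
move=> aE; elim/laurent_ind: l => [i||x y Hx Hy|c x Hx].
- by rewrite -laurentXD !laurent_liftX aE addrC.
- by rewrite amul0r !linear0 amul0r.
- by rewrite amulDr !linearD /= amulDr Hx Hy.
- by rewrite -ascalerAr !linearZ /= -ascalerAr Hx.
Qed.

Lemma theta_amulr a j l : (forall i, loop_pow i ** a = loop_pow (i + j)) ->
  theta l ** a = theta (laurentX k j ** l).
Proof.
move=> aE; elim/laurent_ind: l => [i||x y Hx Hy|c x Hx].
- by rewrite -laurentXD !laurent_liftX aE addrC.
- by rewrite amul0r !linear0 amul0l.
- by rewrite amulDr !linearD /= amulDl Hx Hy.
- by rewrite -ascalerAr !linearZ /= -ascalerAl Hx.
Qed.

Lemma Vx_theta l : Vx v0 ** theta l = theta l.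
Proof.
rewrite (@theta_amull _ 0) ?laurentX0 => [|i]; last by rewrite addr0 Vx_loop_pow.
by congr laurent_lift; apply: mul1r.
Qed.

Lemma theta_Vx l : theta l ** Vx v0 = theta l.
Proof.
rewrite (@theta_amulr _ 0) ?laurentX0 => [|i]; last by rewrite addr0 loop_pow_Vx.
by congr laurent_lift; apply: mul1r.
Qed.

(* The span of the elements [a x0^n b^*] with [a] and [b] paths that end at v0
   and avoid x0: this is the ideal generated by v0. *)
Inductive loop_span : L -> Prop :=
  | loop_span_core l : loop_span (theta l)
  | loop_spanD x y : loop_span x -> loop_span y -> loop_span (x + y)
  | loop_spanZ c x : loop_span x -> loop_span (c *: x)
  | loop_span_edge e x : e != x0 -> loop_span x -> loop_span (Ed e ** x)
  | loop_span_ghost e x : e != x0 -> loop_span x -> loop_span (x ** Gh e).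

Lemma loop_span0 : loop_span 0.
Proof. by rewrite -(linear0 theta); apply: loop_span_core. Qed.

Lemma loop_span_amull g x : loop_span x -> loop_span (lgen g ** x).
Proof.
move=> sx; elim: sx g => {x} [l|x y _ Hx _ Hy|c x _ Hx|e x ex sx Hx|e x ex _ Hx] g.
- rewrite -Vx_theta amulA; case: g => [v|e|e].
  + rewrite VxM; case: eqP => [->|_]; first by rewrite Vx_theta; constructor.
    by rewrite amul0l; apply: loop_span0.
  + have [->|ex] := eqVneq e x0; last first.
      by rewrite -amulA Vx_theta; apply: loop_span_edge => //; constructor.
    by rewrite -amulA Vx_theta (theta_amull _ Ed_loop_pow); constructor.
  + have [->|ex] := eqVneq e x0; last first.
      by rewrite Gh_Vx_eq0 // amul0l; apply: loop_span0.
    by rewrite -amulA Vx_theta (theta_amull _ Gh_loop_pow); constructor.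
- by rewrite amulDr; apply: loop_spanD.
- by rewrite -ascalerAr; apply: loop_spanZ.
- case: g => [v|f|f].
  + rewrite amulA VxEd; case: eqP => _; first exact: loop_span_edge.
    by rewrite amul0l; apply: loop_span0.
  + have [->|fx] := eqVneq f x0; last by do 2!apply: loop_span_edge => //.
    (* The product $x_0e$ vanishes: $x_0$ ends at $v_0$, which emits no edge [e] other than
       $x_0$. *)
    have -> : Ed x0 = Ed x0 ** Vx v0 by rewrite EdVx loop_x0 eqxx.
    rewrite amulA -[_ ** Ed e]amulA Vx_Ed_eq0 // amul0r amul0l.
    exact: loop_span0.
  + rewrite amulA GhEd; case: eqP => _; first exact: Hx.
    by rewrite amul0l; apply: loop_span0.
- by rewrite amulA; apply: loop_span_ghost.
Qed.

Lemma loop_span_amulr g x : loop_span x -> loop_span (x ** lgen g).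
Proof.
move=> sx; elim: sx g => {x} [l|x y _ Hx _ Hy|c x _ Hx|e x ex _ Hx|e x ex sx Hx] g.
- rewrite -theta_Vx -amulA; case: g => [v|e|e].
  + rewrite VxM; case: eqP => [_|_]; first by rewrite theta_Vx; constructor.
    by rewrite amul0r; apply: loop_span0.
  + have [->|ex] := eqVneq e x0; last first.
      by rewrite Vx_Ed_eq0 // amul0r; apply: loop_span0.
    by rewrite amulA theta_Vx (theta_amulr _ loop_pow_Ed); constructor.
  + have [->|ex] := eqVneq e x0; last first.
      by rewrite amulA theta_Vx; apply: loop_span_ghost => //; constructor.
    by rewrite amulA theta_Vx (theta_amulr _ loop_pow_Gh); constructor.
- by rewrite amulDl; apply: loop_spanD.
- by rewrite -ascalerAl; apply: loop_spanZ.
- by rewrite -amulA; apply: loop_span_edge.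
- case: g => [v|f|f].
  + rewrite -amulA GhVx; case: eqP => _; first exact: loop_span_ghost.
    by rewrite amul0r; apply: loop_span0.
  + rewrite -amulA GhEd; case: eqP => _; first exact: Hx.
    by rewrite amul0r; apply: loop_span0.
  + have [->|fx] := eqVneq f x0; last by do 2!apply: loop_span_ghost => //.
    have -> : Gh x0 = Vx v0 ** Gh x0 by rewrite VxGh loop_x0 eqxx.
    rewrite amulA -[x ** _ ** _]amulA Gh_Vx_eq0 // amul0r amul0l.
    exact: loop_span0.
Qed.

Lemma loop_span_ideal : is_ideal loop_span.
Proof.
apply: leavitt_ideal => [|x y|c x|g x|g x].
- exact: loop_span0.
- exact: loop_spanD.
- exact: loop_spanZ.
- exact: loop_span_amull.
- exact: loop_span_amulr.
Qed.

Lemma loop_span_Vx : loop_span (Vx v0).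
Proof. by have := loop_span_core (laurentX k 0); rewrite laurent_liftX. Qed.

(** Multiplication by $v_0$ kills every term with an outer edge or ghost other than $x_0$ and its
    ghost, so only core terms survive. *)
Lemma loop_span_corner x : loop_span x -> exists l, Vx v0 ** x ** Vx v0 = theta l.
Proof.
elim=> {x} [l|x y _ [l Hx] _ [l' Hy]|c x _ [l Hx]|e x ex _ _|e x ex _ _].
- by exists l; rewrite Vx_theta theta_Vx.
- by exists (l + l'); rewrite linearD /= amulDr amulDl Hx Hy.
- by exists (c *: l); rewrite linearZ /= -ascalerAr -ascalerAl Hx.
- by exists 0; rewrite linear0 amulA Vx_Ed_eq0 // !amul0l.
- by exists 0; rewrite linear0 -!amulA Gh_Vx_eq0 // !amul0r.
Qed.

(* The sum of [a a^*] over the paths [a] of length at most n that end at v0 and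
   avoid x0; these are local units for the ideal generated by v0. *)
Fixpoint loop_unit (n : nat) : L :=
  if n is n'.+1 then
    Vx v0 + \sum_(e | e != x0) Ed e ** loop_unit n' ** Gh e
  else Vx v0.

Lemma amul_suml (I : Type) (r : seq I) (P : pred I) (F : I -> L) x :
  (\sum_(i <- r | P i) F i) ** x = \sum_(i <- r | P i) F i ** x.
Proof.
by elim/big_rec2: _ => [|i y z _ <-]; rewrite ?amul0l ?amulDl.
Qed.

Lemma amul_sumr (I : Type) (r : seq I) (P : pred I) (F : I -> L) x :
  x ** (\sum_(i <- r | P i) F i) = \sum_(i <- r | P i) x ** F i.
Proof.
by elim/big_rec2: _ => [|i y z _ <-]; rewrite ?amul0r ?amulDr.
Qed.

(** Each $aa^*$ begins and ends at the same vertex. *)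
Lemma loop_unit_VxC n v : loop_unit n ** Vx v = Vx v ** loop_unit n.
Proof.
have VC : Vx v0 ** Vx v = Vx v ** Vx v0.
  by rewrite !VxM eq_sym; case: eqP => [->|].
case: n => //= n; rewrite amulDl amulDr VC amul_suml amul_sumr; congr (_ + _).
apply: eq_bigr => e _; rewrite -amulA GhVx !amulA VxEd.
by case: eqP; rewrite ?amul0l ?amul0r.
Qed.

Lemma loop_unit_Ed n e : e != x0 -> loop_unit n.+1 ** Ed e = Ed e ** loop_unit n.
Proof.
move=> ex /=; rewrite amulDl Vx_Ed_eq0 // add0r amul_suml (bigD1 e) //=.
rewrite -amulA GhEd eqxx -amulA loop_unit_VxC amulA EdVx eqxx.
rewrite big1 ?addr0 // => f /andP[_ fe].
by rewrite -amulA GhEd (negPf fe) amul0r.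
Qed.

Lemma Gh_loop_unit n e : e != x0 -> Gh e ** loop_unit n.+1 = loop_unit n ** Gh e.
Proof.
move=> ex /=; rewrite amulDr Gh_Vx_eq0 // add0r amul_sumr (bigD1 e) //=.
rewrite !amulA GhEd eqxx -loop_unit_VxC -amulA VxGh eqxx.
rewrite big1 ?addr0 // => f /andP[_ fe].
by rewrite !amulA GhEd eq_sym (negPf fe) !amul0l.
Qed.

Lemma loop_unit_Vx n : loop_unit n ** Vx v0 = Vx v0.
Proof.
case: n => [|n] /=; first by rewrite VxM eqxx.
rewrite amulDl VxM eqxx amul_suml big1 ?addr0 // => e ex.
by rewrite -amulA Gh_Vx_eq0 // amul0r.
Qed.

Lemma loop_span_unit x : loop_span x -> exists n, forall m, (n <= m)%N ->
  loop_unit m ** x = x /\ x ** loop_unit m = x.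
Proof.
elim=> {x} [l|x y _ [n Hx] _ [n' Hy]|c x _ [n Hx]|e x ex _ [n Hx]|e x ex _ [n Hx]].
- exists 0%N => m _; split.
    by rewrite -Vx_theta amulA loop_unit_Vx.
  by rewrite -theta_Vx -amulA -loop_unit_VxC loop_unit_Vx.
- exists (maxn n n') => m; rewrite geq_max => /andP[/Hx[x1 x2] /Hy[y1 y2]].
  by rewrite amulDr amulDl x1 x2 y1 y2.
- exists n => m /Hx[x1 x2].
  by rewrite -ascalerAl -ascalerAr x1 x2.
(* Moving the unit past an edge shortens its paths by one, hence the threshold [n.+1]. *)
- exists n.+1 => -[//|m] nm; split.
    by rewrite amulA loop_unit_Ed // -amulA; case: (Hx m nm) => ->.
  by rewrite -amulA; case: (Hx m.+1 (leqW nm)) => _ ->.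
- exists n.+1 => -[//|m] nm; split.
    by rewrite amulA; case: (Hx m.+1 (leqW nm)) => ->.
  by rewrite -amulA Gh_loop_unit // amulA; case: (Hx m nm) => _ ->.
Qed.

(** Local units on both sides of $x\in K$ reduce its vanishing to that of the corner $v_0Kv_0$,
    which consists of values of [theta]. *)
Lemma loop_span_ideal_eq0 (K : L -> Prop) : is_ideal K ->
    (forall x, K x -> loop_span x) ->
    (forall l, K (theta l) -> theta l = 0) ->
  forall x, K x -> x = 0.
Proof.
move=> idK Kspan Kcore.
have K0 x : K x -> Vx v0 ** x ** Vx v0 = 0.
  move=> Kx; have [l E] := loop_span_corner (Kspan _ Kx).
  by rewrite E; apply: Kcore; rewrite -E; apply: idealMr => //; apply: idealMl.
(* Induction on the length in the right unit: stripping an edge [e] replaces [x] by $xe$, still in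
   [K]. The left unit is treated the same way afterwards. *)
have Kl x : K x -> Vx v0 ** x = 0.
  move=> Kx; have [n /(_ n (leqnn n))[_ <-]] := loop_span_unit (Kspan _ Kx).
  rewrite amulA; elim: n x Kx => [|n IHn] x Kx /=; first exact: K0.
  rewrite amulDr K0 // add0r amul_sumr big1 // => e ex.
  by rewrite !amulA -[_ ** Ed e]amulA IHn ?amul0l //; apply: idealMr.
move=> x Kx; have [n /(_ n (leqnn n))[<- _]] := loop_span_unit (Kspan _ Kx).
elim: n x Kx => [|n IHn] x Kx /=; first exact: Kl.
rewrite amulDl Kl // add0r amul_suml big1 // => e ex.
by rewrite -!amulA IHn ?amul0r //; apply: idealMl.
Qed.

End LoopVertex.

(** * The pullback square of a trimmable graph *)

Section PullbackMap.
Variables (k : fieldType) (D A B C : assocAlgType k).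
Variables (g : {alghom A -> C}) (h : {alghom B -> C}).
Variables (a : {alghom D -> A}) (b : {alghom D -> B}).
Hypothesis gahb : forall p, g (a p) = h (b p).

Fact pullback_map_subproof p : (a p, b p) \in pullback_pred g h.
Proof. by rewrite in_pullback gahb. Qed.

Definition pullback_map p : pullback g h := Pullback (pullback_map_subproof p).

Lemma pullback_map_linear : linear pullback_map.
Proof.
move=> c x y; apply/val_inj; rewrite linearP /=.
by congr pair; rewrite linearP.
Qed.

Lemma pullback_mapM : {morph pullback_map : x y / x ** y}.
Proof. by move=> x y; apply/val_inj; congr pair; rewrite amorphM. Qed.

HB.instance Definition _ := GRing.isLinear.Build k D (pullback g h) *:%R
  pullback_map pullback_map_linear.
HB.instance Definition _ := isAmulMorphism.Build k D (pullback g h)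
  pullback_map pullback_mapM.

End PullbackMap.

Section TrimmedSquare.
Variables (k : fieldType) (Q : graph) (Q' : subgraph Q).
Variables (v0 : vertex Q) (x0 : edge Q) (T : trimmable Q' v0 x0).

Local Notation Q'' := (del_edge x0).
Local Notation pi1 := (pi1 k T).
Local Notation pi2 := (pi2 k T).
Local Notation f := (f_hom k T).
Local Notation pi2_id := (tens_hom pi2 idfun).
Local Notation out0 := (trim_out T).
Local Notation loop0 := (trim_loop T).

Definition full_vertex (v : vertex Q) : vertex Q'' := exist _ v (in_setT v).

Local Notation w0 := (lgen (GVertex (full_vertex v0)) : leavitt k Q'').

Lemma trim_vertexN v : v \notin sub_vertex Q' -> v = v0.
Proof.
move=> nv; have : v \in [set: vertex Q] by rewrite inE.
by rewrite (trim_vertex T) !inE (negPf nv) => /eqP.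
Qed.

Lemma x0_notin : x0 \notin sub_edge Q'.
Proof. by apply/negP => /sub_target; rewrite loop0 (negPf (trim_notin T)). Qed.

Lemma pi1_Vx0 : pi1 (lgen (GVertex v0)) = 0.
Proof. by rewrite pi1E /= insubN // (trim_notin T). Qed.

Lemma f_sub_generator (g : generator Q'') :
  f (lgen (sub_generator g)) = lgen g ⊗ laurentX k (gdegree g).
Proof.
rewrite f_homE; case: g => [v|e|e] /=; rewrite ?valK //.
by rewrite laurentX0; congr (lgen (GVertex _) ⊗ _); apply: val_inj.
Qed.

Lemma f_loop_pow i : f (loop_pow k v0 x0 i) = w0 ⊗ laurentX k i.
Proof.
have fV : f (lgen (GVertex v0)) = w0 ⊗ laurentX k 0 by rewrite f_homE laurentX0.
have ww : w0 ** w0 = w0 by rewrite VxM eqxx.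
have ins : insub x0 = None :> option (edge Q'') by rewrite insubN // !inE eqxx.
rewrite /loop_pow; case: i => n; last rewrite NegzE; last move: n.+1 => {}n.
  elim: n => //= n IHn; rewrite amorphM /= IHn f_homE /= ins.
  by rewrite tens_amul laurent_mulX ww.
elim: n => //= n IHn; rewrite amorphM /= IHn f_homE /= ins.
by rewrite tens_amul laurent_mulX ww -opprD.
Qed.

Lemma f_theta l : f (laurent_lift (loop_pow k v0 x0) l) = w0 ⊗ l.
Proof.
elim/laurent_ind: l => [i||x y Hx Hy|c x Hx].
- by rewrite laurent_liftX f_loop_pow.
- by rewrite !linear0 tens0r.
- by rewrite !linearD /= Hx Hy tensDr.
- by rewrite !linearZ /= Hx tensZr.
Qed.

(** Deleting $x_0$, the only edge out of $v_0$, turns $v_0$ into a sink of $Q''$. *)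
Lemma w0_neq0 : w0 != 0.
Proof.
apply: sink_neq0; apply/setP => e; rewrite !inE.
apply/negP => /eqP /(congr1 val) /= se.
have : val e \in out_edges v0 by rewrite !inE se.
by rewrite out0 inE => /eqP ee; have := valP e; rewrite ee !inE eqxx.
Qed.

(** The generators killed by [pi1] are $v_0$ and the edges into it with their ghosts; all lie in the
    ideal generated by $v_0$. *)
Lemma ker_pi1 x : pi1 x = 0 -> loop_span v0 x0 x.
Proof.
have idI := loop_span_ideal k out0 loop0.
apply: (@ker_in_ideal k Q Q' val val val_inj val_inj) => // [e ne|g].
  have -> : target e = v0.
    apply: (trim_edgeN T); apply: contra ne => eQ.
    by apply/codomP; exists (exist _ e eQ).
  exact: loop_span_Vx.
have IV := loop_span_Vx k v0 x0.
rewrite pi1E; case: g => [v|e|e] /=; case: insubP => [u _ <-|nv].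
- by left; exists (@GVertex Q' u).
- by right; rewrite (trim_vertexN nv); split.
- by left; exists (@GEdge Q' u).
- right; split=> //; have := EdVx k v0 e; rewrite (trim_edgeN T nv) eqxx => <-.
  exact: idealMl.
- by left; exists (@GGhost Q' u).
- right; split=> //; have := VxGh k v0 e; rewrite (trim_edgeN T nv) eqxx => <-.
  exact: idealMr.
Qed.

(** As for [pi1], but for an arbitrary ideal containing $v_0$, so that [ker_pi2_lift] can apply it
    to the ideal of liftable elements. *)
Lemma ker_pi2 (I : leavitt k Q'' -> Prop) : is_ideal I -> I w0 ->
  forall y, pi2 y = 0 -> I y.
Proof.
move=> idI I0 y.
have VE (v : vertex Q'') : val v \notin sub_vertex Q' -> v = full_vertex v0.
  by move=> /trim_vertexN vv; apply: val_inj.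
apply: (@ker_in_ideal k Q'' Q' (fun v => full_vertex (val v))
          (fun e => exist _ (val e) (trim_sub_edge T e))) => //.
- by move=> u v /(congr1 val) E; apply: val_inj.
- by move=> d e /(congr1 val) E; apply: val_inj.
- by move=> e; apply: val_inj.
- by move=> e; apply: val_inj.
- move=> e ne; suff -> : target e = full_vertex v0 by [].
  apply: val_inj; apply: (trim_edgeN T); apply: contra ne => eQ.
  by apply/codomP; exists (exist _ (val e) eQ); apply: val_inj.
have tE (e : edge Q'') : val e \notin sub_edge Q' -> target e = full_vertex v0.
  by move=> /(trim_edgeN T) te; apply: val_inj.
case=> [v|e|e]; rewrite pi2E /pi2_gen /=; case: insubP => [u _ ue|nv].
- by left; exists (@GVertex Q' u) => //=; congr GVertex; apply: val_inj.
- by right; rewrite (VE v).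
- by left; exists (@GEdge Q' u) => //=; congr GEdge; apply: val_inj.
- right; split=> //; have := EdVx k (full_vertex v0) e.
  rewrite (tE e nv) eqxx => <-.
  exact: idealMl.
- by left; exists (@GGhost Q' u) => //=; congr GGhost; apply: val_inj.
- right; split=> //; have := VxGh k (full_vertex v0) e.
  rewrite (tE e nv) eqxx => <-.
  exact: idealMr.
Qed.

(** The intersection of the two kernels is an ideal inside [loop_span], and on its core [f] is
    injective, because [theta l] goes to $v_0\otimes l$ with $v_0\neq 0$. *)
Lemma pi1_f_inj x : pi1 x = 0 -> f x = 0 -> x = 0.
Proof.
move=> px fx; pose K x := pi1 x = 0 /\ f x = 0.
have idK : is_ideal K.
  have [p0 pD pZ pl pr] := ideal_ker pi1; have [f0 fD fZ fl fr] := ideal_ker f.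
  split=> [|y z [py fy] [pz fz]|c y [py fy]|y z [pz fz]|y z [pz fz]].
  - by split; [apply: p0|apply: f0].
  - by split; [apply: pD|apply: fD].
  - by split; [apply: pZ|apply: fZ].
  - by split; [apply: pl|apply: fl].
  - by split; [apply: pr|apply: fr].
apply: (loop_span_ideal_eq0 out0 loop0 idK) => // [y [/ker_pi1]|l [_]] //.
by rewrite f_theta => /(tens_coef_eq0 w0_neq0) ->; rewrite linear0.
Qed.

Lemma ker_pi2_lift y : pi2 y = 0 ->
  forall n, exists2 x, pi1 x = 0 & f x = y ⊗ laurentX k n.
Proof.
move: y; apply: ker_pi2.
  apply: leavitt_ideal => [n|x y Hx Hy n|c x Hx n|g x Hx n|g x Hx n].
  - by exists 0; rewrite linear0 ?tens0l.
  - have [x' px fx] := Hx n; have [y' py fy] := Hy n.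
    exists (x' + y'); first by rewrite linearD /= px py addr0.
    by rewrite linearD /= fx fy tensDl.
  - have [x' px fx] := Hx n; exists (c *: x').
      by rewrite linearZ /= px scaler0.
    by rewrite linearZ /= fx tensZl.
  (* The lift of $g$ contributes $u^{\deg g}$ under [f], so [x] is lifted with the exponent lowered
     by that degree. *)
  - have [x' px fx] := Hx (n - gdegree g).
    exists (lgen (sub_generator g) ** x'); first by rewrite amorphM /= px amul0r.
    by rewrite amorphM /= fx f_sub_generator tens_amul laurent_mulX addrC subrK.
  - have [x' px fx] := Hx (n - gdegree g).
    exists (x' ** lgen (sub_generator g)); first by rewrite amorphM /= px amul0l.
    by rewrite amorphM /= fx f_sub_generator tens_amul laurent_mulX subrK.
move=> n; exists (loop_pow k v0 x0 n); last exact: f_loop_pow.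
by rewrite -(Vx_loop_pow k out0 loop0) amorphM /= pi1_Vx0 amul0l.
Qed.

Lemma ker_pi2_id_lift b : pi2_id b = 0 -> exists2 x, pi1 x = 0 & f x = b.
Proof.
move=> pb; have [s ->] := tens_coef_sum b.
have {pb}coef0 n : pi2 (tens_coef n b) = 0 by rewrite -tens_coef_hom pb linear0.
elim: s => [|n s [x px fx]]; first by exists 0; rewrite ?linear0 ?big_nil.
have [y py fy] := ker_pi2_lift (coef0 n) n.
by exists (y + x); rewrite linearD /= ?px ?py ?addr0 // fx fy big_cons.
Qed.

Lemma pi1_surj y : exists x, pi1 x = y.
Proof.
elim/leavitt_ind: y => [g||_ _ [x <-] [y <-]|c _ [x <-]|_ _ [x <-] [y <-]].
- exists (lgen (sub_generator g)); rewrite pi1E.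
  by case: g => [v|e|e] /=; rewrite valK.
- by exists 0; rewrite linear0.
- by exists (x + y); rewrite linearD.
- by exists (c *: x); rewrite linearZ.
- by exists (x ** y); rewrite amorphM.
Qed.

Lemma pi1_graded : graded_map (@leavitt_homog k Q) (@leavitt_homog k Q') pi1.
Proof.
apply: alghom_homog => [n|n x y|n c x|m n x y|g].
- exact: lhomog0.
- exact: lhomogD.
- exact: lhomogZ.
- exact: lhomogM.
rewrite pi1E; case: g => [v|e|e] /=; case: insubP => [u _ _|_].
all: try exact: lhomog0.
- exact: (lhomog_gen k (@GVertex Q' u)).
- exact: (lhomog_gen k (@GEdge Q' u)).
- exact: (lhomog_gen k (@GGhost Q' u)).
Qed.

Lemma f_graded : graded_map (@leavitt_homog k Q) (@laurent_homog k _) f.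
Proof.
apply: alghom_laurent_homog => -[v|e|e]; rewrite f_homE /=; last 2 first.
- exact: laurent_homog_tens.
- exact: laurent_homog_tens.
rewrite -laurentX0; exact: laurent_homog_tens.
Qed.

Lemma square_commutes p : delta k Q' (pi1 p) = pi2_id (f p).
Proof.
elim/leavitt_ind: p => [g||x y Hx Hy|c x Hx|x y Hx Hy].
- rewrite pi1E f_homE; case: g => [v|e|e] /=; rewrite tens_homE /=.
  + rewrite pi2E /pi2_gen /=; case: insubP => [u _ _|_]; first by rewrite deltaE.
    by rewrite linear0 tens0l.
  (* For $x_0$ both sides vanish: [pi1] kills $x_0$, while [f] sends it to $v_0\otimes u$ and [pi2]
     kills $v_0$. *)
  + have [->|ex] := eqVneq e x0.
      rewrite insubN ?x0_notin // linear0 insubN ?inE ?eqxx // pi2E /pi2_gen /=.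
      by rewrite insubN ?(trim_notin T) // tens0l.
    rewrite [in RHS]insubT ?inE // => eS; rewrite pi2E /pi2_gen /=.
    case: insubP => [u _ _|_]; first by rewrite deltaE.
    by rewrite linear0 tens0l.
  + have [->|ex] := eqVneq e x0.
      rewrite insubN ?x0_notin // linear0 insubN ?inE ?eqxx // pi2E /pi2_gen /=.
      by rewrite insubN ?(trim_notin T) // tens0l.
    rewrite [in RHS]insubT ?inE // => eS; rewrite pi2E /pi2_gen /=.
    case: insubP => [u _ _|_]; first by rewrite deltaE.
    by rewrite linear0 tens0l.
- by rewrite !linear0.
- by rewrite !linearD /= Hx Hy.
- by rewrite !linearZ /= Hx.
- by rewrite !amorphM /= Hx Hy.
Qed.

(** The degree-$n$ component of [a] has the same images under [pi1] and [f] as [a], so joint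
    injectivity identifies the two. *)
Lemma homog_of_pi1_f n a :
  leavitt_homog n (pi1 a) -> laurent_homog n (f a) -> leavitt_homog n a.
Proof.
move=> pa /laurent_homogP[b fa].
suff <- : leavitt_comp n a = a by apply: leavitt_comp_homog.
apply/eqP; rewrite -subr_eq0; apply/eqP; apply: pi1_f_inj.
  rewrite linearB /= (leavitt_comp_hom _ _ pi1_graded).
  by rewrite (delta_homog pa) tens_coefX eqxx scale1r subrr.
rewrite linearB; apply/eqP; rewrite subr_eq0; apply/eqP.
rewrite [LHS](leavitt_comp_laurent _ _ f_graded) fa.
by rewrite tens_coefX eqxx scale1r -fa.
Qed.

Lemma pullback_map_bij : bijective (pullback_map square_commutes).
Proof.
have surj y : exists x, pullback_map square_commutes x = y.
  have [x0' px0] := pi1_surj (val y).1.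
  (* A preimage of the first coordinate is corrected by an element of the kernel of [pi1]; by
     commutativity the error in the second coordinate lies in the kernel of [pi2_id]. *)
  have [x px fx] : exists2 x, pi1 x = 0 & f x = (val y).2 - f x0'.
    apply: ker_pi2_id_lift; rewrite linearB /= -square_commutes px0.
    by have /eqP := valP y => ->; rewrite subrr.
  exists (x0' + x); apply/val_inj => /=; rewrite [RHS]surjective_pairing.
  by rewrite !linearD /= px0 px fx addr0 addrC subrK.
have inj : injective (pullback_map square_commutes).
  move=> x y /(congr1 val) [px fx]; apply/eqP; rewrite -subr_eq0; apply/eqP.
  by apply: pi1_f_inj; rewrite linearB /= ?px ?fx subrr.
exists (fun y => projT1 (cid (surj y))) => [x|y]; last by case: cid.
by apply: inj; case: cid.
Qed.

End TrimmedSquare.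

Theorem theorem3p2 (k : fieldType) (Q : graph) (Q' : subgraph Q)
    (v0 : vertex Q) (x0 : edge Q) (trim : trimmable Q' v0 x0) :
  let pi1 : {alghom leavitt k Q -> leavitt k Q'} := pi1 k trim in
  let pi2 : {alghom leavitt k (del_edge x0) -> leavitt k Q'} := pi2 k trim in
  let f : {alghom leavitt k Q -> leavitt k (del_edge x0) ⊗ laurent k} :=
    f_hom k trim in
  let delta : {alghom leavitt k Q' -> leavitt k Q' ⊗ laurent k} :=
    delta k Q' in
  let pi2_id : {alghom leavitt k (del_edge x0) ⊗ laurent k ->
                       leavitt k Q' ⊗ laurent k} :=
    tens_hom pi2 idfun in
  [/\ [/\ graded_map (@leavitt_homog k Q) (@leavitt_homog k Q') pi1,
          graded_map (@leavitt_homog k Q) (@laurent_homog k _) f,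
          graded_map (@leavitt_homog k Q') (@laurent_homog k _) delta
        & graded_map (@laurent_homog k _) (@laurent_homog k _) pi2_id],
      forall p : leavitt k Q, delta (pi1 p) = pi2_id (f p)
    & exists phi : {alghom leavitt k Q -> pullback delta pi2_id},
        (forall p : leavitt k Q, pullback_val (phi p) = (pi1 p, f p))
        /\ graded_iso (@leavitt_homog k Q)
             (pullback_homog (@leavitt_homog k Q') (@laurent_homog k _)) phi].
Proof.
split; first split.
- exact: pi1_graded.
- exact: f_graded.
- exact: delta_graded.
- exact: tens_hom_homog.
- exact: square_commutes.
- exists (pullback_map (@square_commutes k _ _ _ _ trim)); split=> //; split.
    exact: pullback_map_bij.
  move=> n a; split=> [ha|[]]; last exact: homog_of_pi1_f.
  by split; [apply: pi1_graded|apply: f_graded].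
Qed.
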